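(* The function $t\mapsto p_c(t)$, from $[0,\infty)$ to $[0,1]$, is continuous.
   Context: Majority dynamics on $\mathbb{Z}^2$: for $x,y\in\mathbb{Z}^2$ write $x\sim y$ if $\|x-y\|_2=1$. Majority dynamics $(\eta_t)_{t\ge 0}$ is the continuous-time Markov process on $\{0,1\}^{\mathbb{Z}^2}$ in which each site $x\in\mathbb{Z}^2$ carries an independent rate-one Poisson clock and, whenever the clock of $x$ rings, the opinion of $x$ is updated to the most common opinion among its four neighbors, keeping its current opinion in case of a tie. Equivalently, its generator on local functions $f$ is $$Lf(\eta)=\sum_{x}\big(\mathbf 1_{\{\sum_{y\sim x}\eta(y)\ge 3,\ \eta(x)=0\}}+\mathbf 1_{\{\sum_{y\sim x}\eta(y)\le 1,\ \eta(x)=1\}}\big)\,(f(\eta^x)-f(\eta)),$$ where $\eta^x$ is $\eta$ with the value at $x$ flipped. For $p\in[0,1]$, $\mathbb{P}_p$ denotes the law of the process when $(\eta_0(x))_{x\in\mathbb{Z}^2}$ are i.i.d. Bernoulli$(p)$, independent of the clocks. A configuration $\eta\in\{0,1\}^{\mathbb{Z}^2}$ percolates if the set $\{x:\eta(x)=1\}$ has an infinite connected component in the nearest-neighbor graph $\mathbb{Z}^2$. The critical probability at time $t\ge 0$ is $$p_c(t)=\inf\{p\in[0,1]:\mathbb{P}_p[\eta_t\text{ percolates}]>0\}.$$ *)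

(* Defs.v *)
From HB Require Import structures.
From mathcomp Require Import all_boot all_order all_algebra.
From mathcomp Require Import all_classical all_reals all_analysis.
From mathcomp Require Import zify.
Set Implicit Arguments.
Unset Strict Implicit.
Unset Printing Implicit Defensive.
Import Order.TTheory GRing.Theory Num.Theory.
Import numFieldNormedType.Exports.
Local Open Scope classical_set_scope.
Local Open Scope ring_scope.

Definition site : Type := (int * int)%type.
Definition config : Type := site -> bool.

(* The Euclidean distance is 1 iff its square is. *)
Definition adjacent : rel site :=
  fun x y => (x.1 - y.1) ^+ 2 + (x.2 - y.2) ^+ 2 == 1.

Definition neighbors (x : site) : seq site :=
  [:: (x.1 + 1, x.2); (x.1 - 1, x.2); (x.1, x.2 + 1); (x.1, x.2 - 1)].

Lemma neighbors_uniq x : uniq (neighbors x).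
Proof. by case: x => a b; rewrite /neighbors /= !inE !xpair_eqE; lia. Qed.

Lemma mem_neighbors x y : (y \in neighbors x) = adjacent x y.
Proof.
case: x y => a b [c d]; rewrite /adjacent /neighbors !inE !xpair_eqE /=.
apply/idP/idP; first by nia.
move=> h.
have {h} [[? ?]|[? ?]] : (a - c = 0 /\ (b - d) ^+ 2 = 1) \/
                       ((a - c) ^+ 2 = 1 /\ b - d = 0) by nia.
  have : (b - d = 1) \/ (b - d = -1) by nia.
  lia.
have : (a - c = 1) \/ (a - c = -1) by nia.
lia.
Qed.

(* With four neighbors, 2 ones is the tie. *)
Definition majority (eta : config) (x : site) : bool :=
  let ones := count eta (neighbors x) in
  if (3 <= ones)%N then true else if (ones <= 1)%N then false else eta x.

Definition open_cluster (eta : config) (x : site) : set site :=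
  [set y | eta x /\ exists s : seq site,
    path (fun u v => adjacent u v && eta v) x s /\ last x s = y].

Definition percolates (eta : config) : Prop :=
  exists x, infinite_set (open_cluster eta x).

Section dynamics.
Variable R : realType.

(* A rate-one Poisson clock is encoded by its i.i.d. Exp(1) waiting times. *)
Definition rings (tau : nat -> R) : set R :=
  range (fun n => \sum_(k < n.+1) tau k).

(* Only times t >= 0 are constrained. The left filter t^'- expresses that the
   opinion at a ring is computed from the configuration just before it. *)
Definition majority_path (clock : site -> set R) (xi : config)
    (eta : R -> config) : Prop :=
  [/\ forall x, eta 0 x = xi x,
      forall x s t, 0 <= s -> s <= t ->
        (forall u, s < u -> u <= t -> ~ clock x u) -> eta t x = eta s x
    & forall x t, 0 < t -> clock x t ->
        \forall s \near t^'-, eta t x = majority (eta s) x].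

Definition mutually_independent d (T : measurableType d)
    (P : probability T R) (I : eqType) (F : I -> set (set T)) : Prop :=
  forall (s : seq I) (A : I -> set T), uniq s ->
    (forall i, i \in s -> F i (A i)) ->
    P (\bigcap_(i in [set` s]) A i) = (\prod_(i <- s) P (A i))%E.

(* The index inl x stands for the initial opinion at x, and inr (x, n) for the
   n-th waiting time of the clock of x. *)
Definition sources d (T : measurableType d) (P : probability T R)
    (xi : site -> {RV P >-> bool}) (tau : site -> nat -> {RV P >-> R})
    (i : site + site * nat) : set (set T) :=
  match i with
  | inl x => preimage_set_system setT (xi x) measurable
  | inr (x, n) => preimage_set_system setT (tau x n) measurable
  end.

Definition is_majority_dynamics d (T : measurableType d)
    (P : probability T R) (p : {i01 R})
    (eta : R -> site -> {RV P >-> bool}) : Prop :=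
  exists (xi : site -> {RV P >-> bool}) (tau : site -> nat -> {RV P >-> R}),
  [/\ forall x A, measurable A ->
        distribution P (xi x) A = bernoulli_prob p%:num A,
      forall x n A, measurable A ->
        distribution P (tau x n) A = exponential_prob 1 A,
      mutually_independent P (sources xi tau)
    & {ae P, forall w, majority_path (fun x => rings (fun n => tau x n w))
        (fun x => xi x w) (fun t x => eta t x w)}].

Definition critical_probability (d : {i01 R} -> measure_display)
    (T : forall p, measurableType (d p)) (P : forall p, probability (T p) R)
    (eta : forall p, R -> site -> {RV (P p) >-> bool}) (t : R) : R :=
  inf [set p%:num | p in
    [set p : {i01 R} | (0 < P p [set w | percolates (fun x => eta p t x w)])%E]].

End dynamics.

(* Main.v *)
(* Let p < p'. A site that starts with opinion 1 and never rings up to the final time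
   keeps opinion 1, which by attractiveness is the best possible behaviour of that
   site. Let every site have its own end of time, and move these ends one at a time
   from one of two close times a <= b to the other. Only the event that the site
   rings in (a, b] matters, and on it an increasing functional changes by at most the
   difference D between "starts with 1, never rings" and "starts with 0, never rings".
   Raising the density from p to p' at that site gains at least
   (p' - p) D P(no ring in [0, b]) = (p' - p) D e^(-b), whereas the loss is at most
   D P(ring in (a, b]) <= D (b - a) e^b. Hence for (b - a) e^b <= (p' - p) e^(-b) the
   law of the process at one of the times a, b with density p is dominated by that at
   the other time with density p', on increasing local events, and p_c is locally
   Lipschitz.
   To make this rigorous the process is compared with a synchronous dynamics on finitely
   many sites and time cells: they agree unless two neighbors ring in the same cell or
   a disagreement travels in from the boundary along a long chain of ringing events. *)
Require Import Defs.
From mathcomp Require Import all_boot all_order all_algebra.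
From mathcomp Require Import all_classical all_reals all_analysis.
From mathcomp Require Import measurable_realfun zify ring lra.
Set Implicit Arguments.
Unset Strict Implicit.
Unset Printing Implicit Defensive.
Import Order.TTheory GRing.Theory Num.Theory.
Import numFieldNormedType.Exports.
Local Open Scope classical_set_scope.
Local Open Scope ring_scope.
Local Notation adjacent := Defs.adjacent.

(** * Discrete-time majority dynamics *)

Lemma majority_mono (eta zeta : config) x : (forall y, eta y -> zeta y) ->
  majority eta x -> majority zeta x.
Proof.
move=> le_ez; rewrite /majority.
have := sub_count le_ez (neighbors x).
case: (leqP 3 (count eta _)) => h3 le_c; first by rewrite (leq_trans h3 le_c).
case: (leqP (count eta _) 1) => // h1 ex; case: ifP => // _.
by rewrite leqNgt (leq_trans h1 le_c) /= le_ez.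
Qed.

Lemma eq_majority (eta zeta : config) x : eta x = zeta x ->
  {in neighbors x, eta =1 zeta} -> majority eta x = majority zeta x.
Proof. by move=> ex en; rewrite /majority (eq_in_count en) ex. Qed.

(** Without a tie the own opinion is not consulted, and in a tie [majority zeta x] is [zeta x].
    Hence repeated updates against the same neighbors act as one. *)
Lemma majority_id (eta zeta : config) x : {in neighbors x, eta =1 zeta} ->
  eta x = zeta x \/ eta x = majority zeta x -> majority eta x = majority zeta x.
Proof.
move=> en [|]; first by move/eq_majority; exact.
rewrite /majority (eq_in_count en) => ->.
by case: (3 <= _)%N => //; case: (_ <= 1)%N.
Qed.

Fixpoint dyn (xi : config) (r : site -> nat -> bool) (n : nat) : config :=
  if n is n'.+1
  then fun x => if r x n' then majority (dyn xi r n') x else dyn xi r n' x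
  else xi.

Lemma eq_dyn xi r r' n : (forall x j, (j < n)%N -> r x j = r' x j) ->
  dyn xi r n = dyn xi r' n.
Proof.
elim: n => //= n IHn rr'; rewrite IHn; last by move=> x j /ltnW; exact: rr'.
by apply/funext => x; rewrite rr'.
Qed.

(** Stopping early amounts to suppressing the later rings. So every run can have [n] steps, and the
    end of time can vary from site to site. *)
Lemma dyn_stop xi r m n : (m <= n)%N ->
  dyn xi (fun x j => r x j && (j < m)%N) n = dyn xi r m.
Proof.
elim: n => [|n IHn]; first by rewrite leqn0 => /eqP->.
rewrite leq_eqVlt => /predU1P[->|]; first by apply: eq_dyn => x j ->; rewrite andbT.
rewrite ltnS => mn; rewrite -[RHS]IHn//=; apply/funext => x.
by rewrite ltnNge mn andbF.
Qed.

(* A site that starts from an extreme opinion and never rings keeps it forever;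
   by attractiveness this beats (or is beaten by) any behaviour at that site. *)
Lemma dyn_mono xi r xi' r' n :
  (forall x, [\/ (xi x ==> xi' x) /\ (forall j, (j < n)%N -> r x j = r' x j),
                 xi' x /\ (forall j, (j < n)%N -> ~~ r' x j) |
                 ~~ xi x /\ (forall j, (j < n)%N -> ~~ r x j)]) ->
  forall x, dyn xi r n x -> dyn xi' r' n x.
Proof.
elim: n => [|n IHn] h x /=.
  by case: (h x) => -[] => [/implyP|->|/negPf->].
have {}IHn : forall y, dyn xi r n y -> dyn xi' r' n y.
  apply: IHn => y; case: (h y) => -[hx hr]; [constructor 1|constructor 2|constructor 3];
    split=> // j jn; exact/hr/ltnW.
have never z zi k : (forall j, (j < n.+1)%N -> ~~ zi x j) -> (k <= n.+1)%N ->
    dyn z zi k x = z x.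
  move=> hz; elim: k => //= k IHk kn; rewrite (negPf (hz k kn)) IHk//; exact: ltnW.
case: (h x) => -[hx hr].
- by rewrite hr//; case: ifP => _; [exact: majority_mono|exact: IHn].
- by rewrite (negPf (hr n _))// (never xi' r')// hx.
- by rewrite (negPf (hr n _))// (never xi r)// (negPf hx).
Qed.

(** * Balls of sites and propagation of disagreement *)

Fixpoint site_ball (k : nat) (x : site) : seq site :=
  if k is k'.+1 then x :: flatten [seq site_ball k' y | y <- neighbors x] else [:: x].

Lemma site_ball_center k x : x \in site_ball k x.
Proof. by case: k => [|k]; rewrite inE eqxx. Qed.

Lemma site_ball_neighbor k x y z : y \in neighbors x -> z \in site_ball k y ->
  z \in site_ball k.+1 x.
Proof.
by move=> yx zy; rewrite inE; apply/orP; right; apply/flatten_mapP; exists y.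
Qed.

Lemma path_ball x s y k : path adjacent x s -> (size s <= k)%N -> y \in x :: s ->
  y \in site_ball k x.
Proof.
elim: s x k => [|z s IHs] x k /=.
  by move=> _ _; rewrite inE => /eqP->; exact: site_ball_center.
move=> /andP[xz ps]; case: k => // k; rewrite ltnS => sk.
rewrite inE => /predU1P[->|ys]; first exact: site_ball_center.
by apply: (@site_ball_neighbor _ _ z); [rewrite mem_neighbors|exact: IHs].
Qed.

(* Sequences of k.+1 ringing events along which a disagreement may have travelled
   to x before step j, from the most recent one to the oldest. *)
Fixpoint chains (k : nat) (x : site) (j : nat) : seq (seq (site * nat)) :=
  flatten [seq (if k is k'.+1
                then [seq (x, i) :: c | c <- flatten [seq chains k' y i | y <- neighbors x]]
                else [:: [:: (x, i)]]) | i <- iota 0 j].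

(** A chain consists of [k.+1] decreasing steps below [j] and a choice among four neighbors at each
    of its [k] links. Summing over the most recent step gives the binomial coefficient by Pascal's
    rule. *)
Lemma size_chains k x j : size (chains k x j) = (4 ^ k * 'C(j, k.+1))%N.
Proof.
elim: k x j => [|k IHk] x j.
  rewrite /= size_flatten /shape -map_comp sumnE big_map expn0 mul1n bin1.
  by rewrite (eq_bigr (fun=> 1%N))// sum1_size size_iota.
rewrite /= size_flatten /shape -map_comp sumnE big_map.
transitivity (\sum_(i <- iota 0 j) (4 ^ k.+1 * 'C(i, k.+1)))%N.
  apply: eq_bigr => i _; rewrite /= size_map !size_cat !IHk /= expnS.
  by lia.
elim: j => [|j IHj]; first by rewrite big_nil bin0n muln0.
by rewrite -addn1 iotaD big_cat IHj /= big_seq1 add0n addn1 binS mulnDr addnC.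
Qed.

Local Opaque neighbors.

Lemma size_chain k x j c : c \in chains k x j -> size c = k.+1.
Proof.
elim: k x j c => [|k IHk] x j c /= /flatten_mapP[i _].
  by rewrite inE => /eqP->.
by move=> /mapP[c' /flatten_mapP[y _ /IHk cs] ->] /=; rewrite cs.
Qed.

Lemma chain_lt k x j c : c \in chains k x j -> all (fun u => u.2 < j)%N c.
Proof.
elim: k x j c => [|k IHk] x j c /= /flatten_mapP[i]; rewrite mem_iota add0n /= => ij.
  by rewrite inE => /eqP->; rewrite /= ij.
move=> /mapP[c' /flatten_mapP[y _ /IHk cs] ->] /=; rewrite ij /=.
by apply: sub_all cs => u /ltn_trans; exact.
Qed.

(* The site recorded at a step of the chain is one whose first disagreement occurs
   at that step; as these steps strictly decrease, the sites are distinct. *)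
Lemma disagreement_chain (L : pred site) (r : site -> nat -> bool)
    (e F : nat -> config) (n : nat) :
  (forall x, L x -> e 0%N x = F 0%N x) ->
  (forall x j, L x -> (j < n)%N ->
     e j.+1 x = if r x j then majority (e j) x else e j x) ->
  (forall x j, L x -> (j < n)%N ->
     F j.+1 x = if r x j then majority (F j) x else F j x) ->
  forall k x j, (j <= n)%N -> all L (site_ball k x) -> e j x != F j x ->
  exists2 c, c \in chains k x j & uniq (map fst c) && all (fun u => r u.1 u.2) c.
Proof.
move=> eF0 eS FS k x j jn Lx dis.
(* The extra last condition, that each recorded site disagrees just after its recorded step, is what
   yields distinctness of the sites. *)
suff [c [cc cu cr _]] : exists c, [/\ c \in chains k x j, uniq (map fst c),
    all (fun u => r u.1 u.2) c &
    all (fun u => e u.2.+1 u.1 != F u.2.+1 u.1) c].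
  by exists c => //; rewrite cu.
elim: k x j jn Lx dis => [|k IHk] x j jn /allP Lx dis.
- have Lxx : L x by apply/Lx/site_ball_center.
  have exd : exists i, e i x != F i x by exists j.
  case: (ex_minnP exd) => -[|i] di mini; first by rewrite eF0 ?eqxx in di.
  have ij := mini j dis; have ein : e i x = F i x.
    by apply/eqP; apply: contraT => /mini; rewrite ltnn.
  exists [:: (x, i)]; rewrite /= di andbT; split => //.
    by apply/flatten_mapP; exists i; rewrite ?mem_iota ?inE.
  by apply: contraNT di => /negPf ri; rewrite eS ?FS ?ri ?ein// (leq_trans ij).
- have Lxx : L x by apply/Lx/site_ball_center.
  have exd : exists i, e i x != F i x by exists j.
  case: (ex_minnP exd) => -[|i] di mini; first by rewrite eF0 ?eqxx in di.
  have ij := mini j dis; have ein : e i x = F i x.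
    by apply/eqP; apply: contraT => /mini; rewrite ltnn.
  have lin : (i < n)%N by exact: leq_trans ij jn.
  have rxi : r x i.
    by apply: contraNT di => /negPf ri; rewrite eS ?FS ?ri ?ein.
  have [y yx dy] : exists2 y, y \in neighbors x & e i y != F i y.
    apply/hasP; apply: contraNT di => /hasPn ag; rewrite eS ?FS ?rxi//.
    by apply/eqP/eq_majority => // y /ag; rewrite negbK => /eqP.
  have [|c [cc cu cr cd]] := IHk y i (ltnW lin) _ dy.
    by apply/allP => z zy; apply: Lx; exact: site_ball_neighbor zy.
  exists ((x, i) :: c); rewrite /= rxi di cr cd /=; split => //.
    apply/flatten_mapP; exists i; rewrite ?mem_iota//.
    by apply/mapP; exists c => //; apply/flatten_mapP; exists y.
  (* If [x] recurred with step [i'], it would already disagree at time [i'.+1]; as [i' < i], this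
     contradicts the minimality of [i.+1]. *)
  rewrite cu andbT; apply/negP => /mapP[[x' i'] uc /= xx'].
  have /= := allP cd _ uc; rewrite -xx' => /mini.
  by rewrite ltnS leqNgt; have /= -> := allP (chain_lt cc) _ uc.
Qed.

(** * Self-avoiding open paths and infinite clusters *)

Definition long_path (x : site) (k : nat) (eta : config) : Prop :=
  exists s : seq site,
    [/\ size s = k, uniq (x :: s), path adjacent x s & all eta (x :: s)].

Lemma long_path_mono x k (eta zeta : config) :
  (forall y, y \in site_ball k x -> eta y -> zeta y) ->
  long_path x k eta -> long_path x k zeta.
Proof.
move=> le_ez [s [sk us ps es]]; exists s; split=> //; apply/allP => y ys.
by apply: le_ez; [apply: path_ball ps _ ys; rewrite sk|exact: (allP es)].
Qed.

Lemma long_path_le x k k' eta : (k' <= k)%N -> long_path x k eta ->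
  long_path x k' eta.
Proof.
move=> kk [s [sk us ps es]]; exists (take k' s); rewrite size_takel ?sk//.
have sub: {subset x :: take k' s <= x :: s}.
  by move=> y; rewrite !inE => /predU1P[->|/mem_take ->]; rewrite ?eqxx ?orbT.
split=> //; last by apply/allP => y /sub; exact: (allP es).
- move: us => /= /andP[xs us]; rewrite take_uniq// andbT.
  by apply: contra xs; exact: mem_take.
- exact: take_path.
Qed.

Lemma path_cluster (eta : config) x s : eta x ->
  path (fun u v => adjacent u v && eta v) x s = path adjacent x s && all eta s.
Proof.
move=> _; elim: s x => //= y s IHs x; rewrite IHs.
by case: adjacent; case: (eta y); case: path.
Qed.

(** If no self-avoiding open path of length [k] exists, open paths from [x] can be shortened to fit
    in the ball of radius [k], so the cluster is finite. Conversely, a cluster listed by [S] cannot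
    hold the [(size S).+1] distinct sites of a path of length [size S]. Percolation is thus
    expressed through increasing local events. *)
Lemma infinite_clusterP (eta : config) x :
  infinite_set (open_cluster eta x) <-> forall k, long_path x k eta.
Proof.
split=> [inf k|lp].
- have [//|nlp] := pselect (long_path x k eta); exfalso.
  apply: inf; apply: (@sub_finite_set _ _ [set` site_ball k x]); last exact: finite_seq.
  move=> y [ex [s]]; rewrite path_cluster//= => -[/andP[ps es] <-].
  have [s' ps' us' ss'] := shortenP ps.
  have [sk|ks] := leqP (size s') k.
    by apply: (path_ball ps' sk); exact: mem_last.
  exfalso; apply: nlp; apply: (@long_path_le x (size s')); first exact: ltnW.
  exists s'; split=> //=; rewrite ex; apply/allP => z /ss'; exact: (allP es).
- move=> /finite_seqP[S SE].
  have [s [ss us ps /= /andP[ex es]]] := lp (size S).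
  have : {subset x :: s <= S}.
    move=> y ys; have : [set` S] y; last by [].
    rewrite -SE; split=> //.
    move: ys; rewrite inE => /predU1P[->|]; first by exists [::].
    move=> /path.splitP; case E : _ _ _ / => [s1 s2].
    exists (rcons s1 y); rewrite last_rcons path_cluster//; split=> //.
    move: ps es; rewrite E cat_path all_cat => /andP[-> _] /andP[-> _] //.
  by move=> /(uniq_leq_size us) /=; rewrite ss ltnn.
Qed.

(** * Comparison of finite expectations *)

(* The initial opinion of a site, and the time cells in which it rings. *)
Definition datum (n : nat) : Type := (bool * n.-tuple bool)%type.

Definition quiet (n : nat) : n.-tuple bool := nseq_tuple n false.

Definition upd n (d : site -> datum n) (x : site) (v : datum n) : site -> datum n :=
  fun y => if y == x then v else d y.

(* Rings of x in the cells from T x on are ignored: T x is the end of time of x. *)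
Definition run n (T : site -> nat) (d : site -> datum n) : config :=
  dyn (fun x => (d x).1) (fun x j => nth false (d x).2 j && (j < T x)%N) n.

(** The three alternatives of [dyn_mono] at a single site, with rings cut off at the ends of time
    [l] and [l']. *)
Definition dominated n (l : nat) (v : datum n) (l' : nat) (v' : datum n) : Prop :=
  [\/ (v.1 ==> v'.1) /\ (forall j, (j < n)%N ->
        nth false v.2 j && (j < l)%N = nth false v'.2 j && (j < l')%N),
      v'.1 /\ (forall j, (j < n)%N -> ~~ (nth false v'.2 j && (j < l')%N)) |
      ~~ v.1 /\ (forall j, (j < n)%N -> ~~ (nth false v.2 j && (j < l)%N))].

Lemma dominated_refl n l (v : datum n) : dominated l v l v.
Proof. by constructor 1; rewrite implybb. Qed.

Lemma dominated_top n l (v : datum n) l' : dominated l v l' (true, quiet n).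
Proof. by constructor 2; split=> // j jn; rewrite nth_nseq jn. Qed.

Lemma dominated_bot n l (v : datum n) l' : dominated l' (false, quiet n) l v.
Proof. by constructor 3; split=> // j jn; rewrite nth_nseq jn. Qed.

Section finite_expectation.
Context {R : realFieldType} {n : nat}.
Implicit Types (wt : datum n -> R) (d : site -> datum n) (s : seq site).

(** Expectation over independent data at the distinct sites of [s], with [d] as boundary condition
    elsewhere. The recursion exposes one site, as needed for changing sites one at a time. *)
Fixpoint expect wt s (f : (site -> datum n) -> R) d : R :=
  if s is x :: s' then \sum_v wt v * expect wt s' f (upd d x v) else f d.

Definition weight (p : R) (mu : n.-tuple bool -> R) (v : datum n) : R :=
  (if v.1 then p else 1 - p) * mu v.2.

Variable A : config -> bool.
Hypothesis A_mono : forall eta zeta : config, (forall x, eta x -> zeta x) ->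
  A eta -> A zeta.

Let f (T : site -> nat) d : R := (A (run T d))%:R.

(** Both sides use the same data on [s]. Under this coupling only sites outside [s] have to be
    compared, and [dyn_mono] orders the two runs for each choice of data. *)
Lemma expect_dominated wt s T d T' d' : (forall v, 0 <= wt v) ->
  (forall x, x \notin s -> dominated (T x) (d x) (T' x) (d' x)) ->
  {in s, T =1 T'} ->
  expect wt s (f T) d <= expect wt s (f T') d'.
Proof.
move=> wt0; elim: s d d' => [|x s IHs] d d' dom eqT /=.
  rewrite ler_nat; case E : (A (run T d)) => //; rewrite (A_mono _ E)// => y.
  by apply: dyn_mono => z; exact: dom.
apply: ler_sum => v _; apply: ler_wpM2l => //; apply: IHs.
  move=> y ys; rewrite /upd; case: eqP => [->|/eqP yx].
    by rewrite eqT ?inE ?eqxx//; exact: dominated_refl.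
  by apply: dom; rewrite inE negb_or yx.
by move=> y ys; apply: eqT; rewrite inE ys orbT.
Qed.

Lemma sum_weight p mu (g : datum n -> R) :
  \sum_v weight p mu v * g v =
  \sum_rho mu rho * (p * g (true, rho) + (1 - p) * g (false, rho)).
Proof.
rewrite (eq_bigr (fun v => weight p mu (v.1, v.2) * g (v.1, v.2))); last by case.
rewrite -(pair_bigA _ (fun b rho => weight p mu (b, rho) * g (b, rho)))/=.
rewrite big_bool/= -big_split/=; apply: eq_bigr => rho _.
by rewrite /weight/=; ring.
Qed.

(* Changing g into g' costs at most [mu E * (gT - gB)], while raising the density
   from p to p' gains at least [(p' - p) * mu quiet * (gT - gB)]. *)
Lemma one_site_comparison (p p' : R) mu (E : pred (n.-tuple bool))
    (g g' : datum n -> R) :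
  0 <= p -> p <= p' -> p' <= 1 -> (forall rho, 0 <= mu rho) ->
  \sum_(rho | E rho) mu rho <= (p' - p) * mu (quiet n) ->
  (forall b rho, ~~ E rho -> g (b, rho) <= g' (b, rho)) ->
  (forall v, g v <= g' (true, quiet n)) ->
  (forall v, g' (false, quiet n) <= g' v) ->
  (forall rho, g' (false, rho) <= g' (true, rho)) ->
  \sum_v weight p mu v * g v <= \sum_v weight p' mu v * g' v.
Proof.
move=> p0 pp' p'1 mu0 muE gg' gT gB g'01; rewrite !sum_weight.
pose D := g' (true, quiet n) - g' (false, quiet n).
have D0 : 0 <= D by rewrite subr_ge0.
have p1 := le_trans pp' p'1.
(* On [E], [gT] and [gB] together give [g v <= g' v + D]; off [E] there is no loss. *)
apply: (@le_trans _ _ (\sum_rho mu rho *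
    (p * g' (true, rho) + (1 - p) * g' (false, rho)) +
    \sum_(rho | E rho) mu rho * D)).
  rewrite [X in _ <= _ + X]big_mkcond -big_split/=; apply: ler_sum => rho _.
  case: ifPn => Er.
    rewrite -mulrDr; apply: ler_wpM2l => //.
    have h1 := gT (true, rho); have h2 := gT (false, rho).
    have h3 := gB (true, rho); have h4 := gB (false, rho).
    have : p * g (true, rho) <= p * (g' (true, rho) + D).
      by apply: ler_wpM2l => //; rewrite /D; lra.
    have : (1 - p) * g (false, rho) <= (1 - p) * (g' (false, rho) + D).
      by apply: ler_wpM2l; rewrite ?subr_ge0// /D; lra.
    by lra.
  rewrite addr0; apply: ler_wpM2l => //; apply: lerD; apply: ler_wpM2l;
    rewrite ?subr_ge0//; exact: gg'.
rewrite -mulr_suml.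
apply: (@le_trans _ _ (\sum_rho mu rho *
    (p * g' (true, rho) + (1 - p) * g' (false, rho)) +
    (p' - p) * mu (quiet n) * D)).
  by rewrite lerD2l ler_wpM2r.
rewrite -lerBrDl -sumrB.
rewrite (eq_bigr (fun rho => (p' - p) * (mu rho * (g' (true, rho) - g' (false, rho)))));
  last by move=> rho _; ring.
rewrite -mulr_sumr -mulrA ler_wpM2l ?subr_ge0//.
(* Only the gain from the quiet pattern is kept; the other terms are nonnegative by [g'01]. *)
rewrite (bigD1 (quiet n))//= lerDl; apply: sumr_ge0 => rho _.
by rewrite mulr_ge0 ?subr_ge0.
Qed.

(** Induction over the sites: the tail of [s] receives its new density and end of time first, then
    [one_site_comparison] treats the head. Passing from [l] to [l'] there matters only for patterns
    with a ring in a cell from [m] on. *)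
Lemma expect_comparison (p p' : R) mu (m l l' : nat) s T T' d :
  0 <= p -> p <= p' -> p' <= 1 -> (forall rho, 0 <= mu rho) ->
  \sum_(rho : n.-tuple bool | [exists j : 'I_n, tnth rho j && (m <= j)%N]) mu rho
    <= (p' - p) * mu (quiet n) ->
  (m <= l)%N -> (m <= l')%N -> uniq s ->
  (forall x, T x = if x \in s then l else T' x) -> {in s, forall x, T' x = l'} ->
  expect (weight p mu) s (f T) d <= expect (weight p' mu) s (f T') d.
Proof.
move=> p0 pp' p'1 mu0 muE ml ml'; elim: s T T' d => [|x s IHs] T T' d /=.
  by move=> _ TT' _; rewrite (_ : T = T')//; apply/funext => x; rewrite TT'.
move=> /andP[xs us] TT' T'l.
(* Intermediate ends of time: already [T'] on the tail, still [l] at [x]. *)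
pose T1 y := if y \in s then T' y else T y.
have w0 v : 0 <= weight p' mu v.
  rewrite /weight mulr_ge0//; case: v.1; rewrite ?subr_ge0//.
  exact: le_trans pp'.
have T1T' y : y != x -> T1 y = T' y.
  by move=> yx; rewrite /T1 TT' inE (negPf yx)/=; case: (y \in s).
apply: (@le_trans _ _ (\sum_v weight p mu v *
    expect (weight p' mu) s (f T1) (upd d x v))).
  apply: ler_sum => v _; apply: ler_wpM2l.
    rewrite /weight mulr_ge0//; case: v.1; rewrite ?subr_ge0//.
    exact: le_trans p'1.
  apply: IHs => //.
    by move=> y; rewrite /T1 TT' inE; case: (y \in s); rewrite ?orbT.
  by move=> y ys; rewrite /T1 ys T'l// inE ys orbT.
have ds y v v' : y \notin s -> dominated (T1 x) v (T' x) v' ->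
    dominated (T1 y) (upd d x v y) (T' y) (upd d x v' y).
  move=> ys dv; rewrite /upd; case: eqP => [->//|/eqP yx].
  by rewrite T1T'//; exact: dominated_refl.
have ds' y v v' : y \notin s -> dominated (T' x) v (T' x) v' ->
    dominated (T' y) (upd d x v y) (T' y) (upd d x v' y).
  move=> ys dv; rewrite /upd; case: eqP => [->//|/eqP yx].
  exact: dominated_refl.
have eqs : {in s, T1 =1 T'}.
  by move=> y ys; apply: T1T'; apply: contraNneq xs => <-.
apply: (one_site_comparison p0 pp' p'1 mu0 muE) => [b rho nE|v|v|rho].
- apply: expect_dominated => // y /ds; apply; constructor 1 => /=.
  rewrite implybb; split=> // j jn.
  have -> : T1 x = l by rewrite /T1 (negPf xs) TT' inE eqxx.
  rewrite T'l ?inE ?eqxx//; case rj : (nth false rho j) => //=.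
  (* A pattern outside the exceptional set rings only before [m], and [m] is below both ends, so
     neither end removes a ring. *)
  have jm : (j < m)%N.
    rewrite ltnNge; apply: contra nE => mj; apply/existsP; exists (Ordinal jn).
    by rewrite (tnth_nth false) rj.
  by rewrite !(leq_trans jm).
- by apply: expect_dominated => // y /ds; apply; exact: dominated_top.
- by apply: expect_dominated => // y /ds'; apply; exact: dominated_bot.
- apply: expect_dominated => // y /ds'; apply; constructor 1; split=> //.
Qed.

End finite_expectation.

(** * Exponential clocks *)

Section exponential_intervals.
Context {R : realType}.
Local Open Scope ereal_scope.

(** The density of the exponential law of rate one is at most 1. *)
Lemma exponential_prob_itv_le (u v : R) : (u <= v)%R ->
  exponential_prob 1 `]u, v] <= (v - u)%:E.
Proof.
move=> uv; rewrite /exponential_prob.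
apply: (@le_trans _ _ (\int[lebesgue_measure]_(x in `]u, v]) cst 1 x)).
  apply: ge0_le_integral => //.
  - by move=> x _; rewrite lee_fin exponential_pdf_ge0.
  - apply/measurable_EFinP; apply: measurable_funTS.
    exact: measurable_exponential_pdf.
  - move=> x _; rewrite lee_fin; have [x0|x0] := leP 0%R x.
      by rewrite exponential_pdfE// mul1r mulN1r -expR0 ler_expR oppr_le0.
    by rewrite lt0_exponential_pdf.
rewrite integral_cst// mul1e/= lebesgue_measure_itv/=; case: ifP => // _.
by rewrite lee_fin subr_ge0.
Qed.

Lemma exponential_prob_lt0 : exponential_prob 1 `]-oo, 0%R[ = 0 :> \bar R.
Proof.
apply: integral0_eq => x /=; rewrite in_itv/= => x0.
by rewrite lt0_exponential_pdf.
Qed.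

End exponential_intervals.

Lemma le_measure_ae d (T : measurableType d) (R : realType)
    (P : probability T R) (A B : set T) : measurable A -> measurable B ->
  {ae P, forall w, A w -> B w} -> (P A <= P B)%E.
Proof.
move=> mA mB [N [mN PN sub]].
have : A `<=` B `|` N.
  move=> w Aw; have [Bw|nB] := pselect (B w); [by left|right].
  by apply: sub => /(_ Aw).
move=> /(le_measure P); rewrite !inE => /(_ mA (measurableU _ _ mB mN)).
move=> /le_trans; apply; apply: le_trans (measureU2 _ _ _) _ => //.
have PN' : (P N <= 0)%E by rewrite PN.
by rewrite -[leRHS]adde0; apply: leeD.
Qed.

Definition psum (R : realType) (f : nat -> R) (n : nat) : R := \sum_(k < n.+1) f k.

Definition ring_in (R : realType) (u v : R) : set (nat -> R) :=
  [set f | exists n, u < psum f n <= v].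

(** Measurable rectangles that constrain only the first [N] waiting times. They form a pi-system,
    and the sigma-algebras they generate for growing [N] are the filtration of the clock. *)
Definition cylinders (R : realType) (N : nat) : set (set (nat -> R)) :=
  [set E | exists A : nat -> set R, [/\ forall n, measurable (A n),
     forall n, (N <= n)%N -> A n = setT & E = [set f | forall n, A n (f n)]]].

Definition all_cylinders (R : realType) : set (set (nat -> R)) :=
  [set E | exists N, cylinders N E].

Section sequence_space.
Context {R : realType}.
Implicit Types (E : set (nat -> R)) (N : nat).

Lemma cylindersW N N' E : (N <= N')%N -> cylinders N E -> cylinders N' E.
Proof.
by move=> NN' [A [mA AT ->]]; exists A; split=> // n /(leq_trans NN') /AT.
Qed.

Lemma cylindersI N : setI_closed (@cylinders R N).
Proof.
move=> _ _ [A [mA AT ->]] [B [mB BT ->]]; exists (fun n => A n `&` B n); split.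
- by move=> n; exact: measurableI.
- by move=> n Nn; rewrite AT// BT// setTI.
- apply/seteqP; split => f /=; first by move=> [fA fB] n; split.
  by move=> fAB; split=> n; case: (fAB n).
Qed.

Lemma all_cylindersI : setI_closed (@all_cylinders R).
Proof.
move=> A B [N cA] [N' cB]; exists (maxn N N'); apply: cylindersI.
  exact: cylindersW (leq_maxl _ _) cA.
exact: cylindersW (leq_maxr _ _) cB.
Qed.

Lemma cylindersT N : @cylinders R N setT.
Proof. by exists (fun=> setT); split => //; apply/seteqP; split. Qed.

Lemma sigma_cylindersW N : <<s @cylinders R N >> `<=` <<s @all_cylinders R >>.
Proof.
apply: smallest_sub; first exact: smallest_sigma_algebra.
by move=> E cE; apply: sub_sigma_algebra; exists N.
Qed.

Lemma measurable_psum N n : (n < N)%N ->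
  measurable_fun setT
    (fun f : g_sigma_algebraType (@cylinders R N) => psum (f : nat -> R) n).
Proof.
move=> nN; apply: measurable_sum => -[k /= kn] _ B mB; rewrite setTI.
apply: sub_sigma_algebra.
exists (fun i => if i == k then B else setT); split.
- by move=> i; case: eqP.
- by move=> i Ni; case: eqP => // ik; move: Ni; rewrite ik leqNgt (leq_trans kn nN).
- apply/seteqP; split => f /=; last by move=> /(_ k); rewrite eqxx.
  by move=> Bf i; case: eqP => // ->.
Qed.

Lemma sigma_psum N n (B : set R) : (n < N)%N -> measurable B ->
  <<s @cylinders R N >> [set f | B (psum f n)].
Proof.
by move=> nN mB; have := measurable_psum nN measurableT mB; rewrite setTI.
Qed.

Lemma sigma_ring_in (u v : R) : <<s @all_cylinders R >> (ring_in u v).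
Proof.
rewrite (_ : ring_in u v = \bigcup_n [set f | `]u, v]%classic (psum f n)]).
  apply: (@bigcupT_measurable _ (g_sigma_algebraType (@all_cylinders R))) => n.
  by apply: (@sigma_cylindersW n.+1); exact: sigma_psum.
apply/seteqP; split => f [n]; first by move=> h; exists n => //=; rewrite in_itv.
by move=> _ /=; rewrite in_itv => h; exists n.
Qed.

End sequence_space.

(** * Extension of identities from a pi-system *)

Section pi_lambda.
Context {R : realType} {S : pointedType} (G : set (set S)).
Hypotheses (GI : setI_closed G) (GT : G setT).

Lemma measurable_preimage_sigma d (T : measurableType d) (f : T -> S) :
  (forall E, G E -> measurable (f @^-1` E)) ->
  forall E, <<s G >> E -> measurable (f @^-1` E).
Proof.
move=> mG E sE.
have : measurable_fun setT (f : T -> g_sigma_algebraType G).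
  by apply: (@measurability _ _ T (g_sigma_algebraType G) setT f G) => // _ [B GB <-]; rewrite setTI; exact: mG.
by move=> /(_ measurableT E sE); rewrite setTI.
Qed.

(** Uniqueness of measures applied to the two images on [S]; the maps may start from different
    spaces. *)
Lemma preimage_measure_unique d1 (T1 : measurableType d1)
    d2 (T2 : measurableType d2) (m1 : {measure set T1 -> \bar R})
    (m2 : {measure set T2 -> \bar R}) (f1 : T1 -> S) (f2 : T2 -> S) :
  (forall E, G E -> measurable (f1 @^-1` E)) ->
  (forall E, G E -> measurable (f2 @^-1` E)) ->
  (m1 setT < +oo)%E ->
  (forall E, G E -> m1 (f1 @^-1` E) = m2 (f2 @^-1` E)) ->
  forall E, <<s G >> E -> m1 (f1 @^-1` E) = m2 (f2 @^-1` E).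
Proof.
move=> mf1 mf2 m1oo eqG E sE.
have mF1 : measurable_fun setT (f1 : T1 -> g_sigma_algebraType G).
  by move=> _ B sB; rewrite setTI; exact: measurable_preimage_sigma.
have mF2 : measurable_fun setT (f2 : T2 -> g_sigma_algebraType G).
  by move=> _ B sB; rewrite setTI; exact: measurable_preimage_sigma.
pose M1 := measure_function_pushforward__canonical__measure_function_Measure m1 mF1.
pose M2 := measure_function_pushforward__canonical__measure_function_Measure m2 mF2.
apply: (@g_sigma_algebra_measure_unique _ R (g_sigma_algebraType G) G _
  (fun=> setT) _ _ M1 M2) => //.
- by move=> A GA; exact: sub_sigma_algebra.
- by apply/seteqP; split => // x _; exists 0%N.
Qed.

(** The restriction of [P] to [D] and the multiple of [P] by [P D] have finite images under [f],
    which agree on the pi-system [G] and hence on the sigma-algebra it generates. *)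
Lemma independent_sigma d (T : measurableType d) (P : probability T R)
    (f : T -> S) (D : set T) : measurable D ->
  (forall E, G E -> measurable (f @^-1` E)) ->
  (forall E, G E -> P (f @^-1` E `&` D) = (P (f @^-1` E) * P D)%E) ->
  forall E, <<s G >> E -> P (f @^-1` E `&` D) = (P (f @^-1` E) * P D)%E.
Proof.
move=> mD mf indG E sE.
have PD0 : 0 <= fine (P D) by exact: fine_ge0.
pose m2 := mscale (NngNum PD0) P.
have m2E A : m2 A = (P A * P D)%E.
  by rewrite /m2 /mscale/= fineK ?fin_num_measure// muleC.
rewrite -m2E -[LHS]/(mrestr P mD (f @^-1` E)).
apply: preimage_measure_unique sE => //.
- by rewrite /= /mrestr setTI ltey_eq fin_num_measure.
- by move=> B GB; apply: etrans (esym (m2E _)); exact: indG.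
Qed.

End pi_lambda.

Definition seqmap d (T : measurableType d) (R : realType) (P : probability T R)
  (tau : nat -> {RV P >-> R}) (w : T) : nat -> R := fun n => tau n w.

Definition iid_exponential d (T : measurableType d) (R : realType)
    (P : probability T R) (tau : nat -> {RV P >-> R}) : Prop :=
  (forall n A, measurable A -> P (tau n @^-1` A) = exponential_prob 1 A) /\
  (forall N (A : nat -> set R), (forall n, measurable (A n)) ->
    P (\bigcap_(n in `I_N) tau n @^-1` A n) =
    (\prod_(n < N) P (tau n @^-1` A n))%E).

Section exponential_sequence.
Context d (T : measurableType d) (R : realType) (P : probability T R).
Variable tau : nat -> {RV P >-> R}.
Implicit Types (E : set (nat -> R)) (b u v : R).

Lemma seqmap_cylinder N (A : nat -> set R) :
  (forall n, (N <= n)%N -> A n = setT) ->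
  seqmap tau @^-1` [set f | forall n, A n (f n)] =
  \bigcap_(n in `I_N) tau n @^-1` A n.
Proof.
move=> AT; apply/seteqP; split => w /= h; first by move=> n _; exact: h.
by move=> n; have [/AT->//|] := leqP N n; exact: h.
Qed.

Lemma measurable_tau n (A : set R) : measurable A -> measurable (tau n @^-1` A).
Proof. by move=> mA; rewrite -[X in measurable X]setTI; exact: measurable_funP. Qed.

Lemma measurable_seqmap_cylinder E : all_cylinders E -> measurable (seqmap tau @^-1` E).
Proof.
move=> [N [A [mA AT ->]]]; rewrite (seqmap_cylinder AT).
apply: bigcap_measurableType => n _; exact: measurable_tau.
Qed.

Lemma measurable_seqmap E : <<s @all_cylinders R >> E -> measurable (seqmap tau @^-1` E).
Proof. by apply: measurable_preimage_sigma; exact: measurable_seqmap_cylinder. Qed.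

Hypothesis tauP : iid_exponential tau.
Let law : forall n A, measurable A -> P (tau n @^-1` A) = exponential_prob 1 A :=
  proj1 tauP.

Lemma measurable_psum_tau n (B : set R) : measurable B ->
  measurable [set w | B (psum (seqmap tau w) n)].
Proof.
move=> mB; apply: (@measurable_seqmap [set f | B (psum f n)]).
by apply: (@sigma_cylindersW _ n.+1); exact: sigma_psum.
Qed.

(** A waiting time is independent of the past of the clock: on rectangles this is the product
    formula with one more factor, and [independent_sigma] extends it. *)
Lemma independent_next N E (B : set R) : <<s @cylinders R N >> E -> measurable B ->
  P (seqmap tau @^-1` E `&` tau N @^-1` B) =
  (P (seqmap tau @^-1` E) * P (tau N @^-1` B))%E.
Proof.
move=> sE mB; apply: (independent_sigma (@cylindersI _ N)) sE.
- exact: cylindersT.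
- exact: measurable_tau.
- by move=> F cF; apply: measurable_seqmap_cylinder; exists N.
move=> _ [A [mA AT ->]]; rewrite (seqmap_cylinder AT).
pose A' n := if n == N then B else A n.
have mA' n : measurable (A' n) by rewrite /A'; case: eqP.
transitivity (P (\bigcap_(n in `I_N.+1) tau n @^-1` A' n)).
  congr (P _); rewrite /A'; apply/seteqP; split => w /=.
    move=> [hA hB] n nN; case: eqP => [->//|/eqP nN']; apply: hA.
    by move: nN; rewrite /= ltnS leq_eqVlt (negPf nN').
  move=> h; split; last by have := h N (ltnSn N); rewrite eqxx.
  move=> n /= nN; have := h n (ltnW nN); rewrite ifF//.
  by apply/negP => /eqP nE; rewrite nE ltnn in nN.
rewrite (proj2 tauP)// (proj2 tauP)// big_ord_recr/= /A' eqxx; congr (_ * _)%E.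
by apply: eq_bigr => -[n nN] _ /=; rewrite ltn_eqF.
Qed.

Lemma ae_tau_ge0 : {ae P, forall w, forall n, 0 <= tau n w}.
Proof.
apply: ae_foralln => n; exists (tau n @^-1` `]-oo, 0[); split.
- exact: measurable_tau.
- exact: etrans (law n (measurable_itv _)) exponential_prob_lt0.
- move=> w /= /negP; rewrite -ltNge => h; by rewrite in_itv/=.
Qed.

Lemma prob_tau_le n b : 0 < b -> P (tau n @^-1` `]-oo, b]) = (1 - expR (- b))%:E.
Proof.
move=> b0; rewrite (_ : `]-oo, b]%classic = `]-oo, 0[ `|` `[0, b]); last first.
  by rewrite (@itv_bndbnd_setU _ _ _ (BLeft 0))// bnd_simp ltW.
transitivity (P (tau n @^-1` `]-oo, 0%R[) + P (tau n @^-1` `[0%R, b]))%E; last first.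
  by rewrite !law// exponential_prob_lt0 add0e exponential_prob_itv0c// mulN1r.
rewrite preimage_setU; apply: measureU; [exact: measurable_tau|exact: measurable_tau|].
apply/seteqP; split => // w /= []; rewrite !in_itv/= => h.
by rewrite leNgt h.
Qed.

(** A sum of nonnegative waiting times is at most [b] only if each of them is. This crude geometric
    bound is enough for summability. *)
Lemma prob_psum_le n b : 0 < b ->
  (P [set w | (psum (seqmap tau w) n <= b)%R] <= ((1 - expR (- b)) ^+ n.+1)%:E)%E.
Proof.
move=> b0.
have mI : measurable [set w | (psum (seqmap tau w) n <= b)%R].
  rewrite (_ : mkset _ = [set w | `]-oo, b]%classic (psum (seqmap tau w) n)]).
    exact: measurable_psum_tau.
  by apply/seteqP; split => w /=; rewrite in_itv.
apply: (@le_trans _ _ (P (\bigcap_(k in `I_n.+1) tau k @^-1` `]-oo, b]))).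
  apply: le_measure_ae => //.
    apply: bigcap_measurableType => k _; exact: measurable_tau.
  apply: filterS ae_tau_ge0 => w tau0 /= h k /= kn; rewrite in_itv/=.
  apply: le_trans h; rewrite /psum (bigD1 (Ordinal kn))//= lerDl.
  by apply: sumr_ge0 => i _; exact: tau0.
rewrite (proj2 tauP)//; under eq_bigr do rewrite prob_tau_le//.
by rewrite prodEFin lee_fin prodr_const card_ord.
Qed.

(** Given the preceding ring time [x], the next waiting time must fall in an interval of length
    [v - u], which has probability at most [v - u]. The other factor bounds the probability that the
    preceding ring comes by time [v]. *)
Lemma prob_psum_itv n u v b : 0 < b -> u <= v -> v <= b ->
  (P [set w | (u < psum (seqmap tau w) n.+1 <= v)%R] <=
   ((v - u) * (1 - expR (- b)) ^+ n.+1)%:E)%E.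
Proof.
move=> b0 uv vb.
pose S := fun w => psum (seqmap tau w) n.
have mS : measurable_fun setT S.
  by move=> _ B mB; rewrite setTI; exact: measurable_psum_tau.
pose X : {RV P >-> R} := mfun_Sub (mem_set mS).
have XS w : X w = S w by [].
pose Y := tau n.+1.
(* The condition [z.1 <= v] holds almost surely on the event, as waiting times are nonnegative; it
   is included to produce the second factor. *)
pose Z : set (R * R) := [set z | z.1 <= v] `&` [set z | u < z.1 + z.2 <= v].
have mZ : measurable Z.
  rewrite (_ : Z = fst @^-1` `]-oo, v] `&` (fun z => z.1 + z.2) @^-1` `]u, v]); last first.
    by apply/seteqP; split => -[x y]; rewrite /Z /= !in_itv.
  apply: measurableI; rewrite -[X in measurable X]setTI.
    exact: measurable_fst.
  by apply: measurable_funD => //; exact: measurable_fst || exact: measurable_snd.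
have mXY : measurable_fun setT (fun w => (X w, Y w)).
  by apply: measurable_fun_pair; exact: measurable_funP.
pose m' := measure_function_pushforward__canonical__measure_function_Measure P mXY.
(* The joint law of a ring time and the next waiting time is the product of their laws, by
   [independent_next] on rectangles. *)
have prodE : (distribution P X \x distribution P Y)%E Z = m' Z.
  apply: product_measure_unique => // A B mA mB.
  apply: (independent_next (E := [set f | A (psum f n)])) => //.
  exact: sigma_psum.
have PZ : P [set w | Z (X w, Y w)] = m' Z by [].
apply: (@le_trans _ _ (P [set w | Z (X w, Y w)])).
  apply: le_measure_ae.
  - rewrite (_ : mkset _ = [set w | `]u, v]%classic (psum (seqmap tau w) n.+1)]).
      exact: measurable_psum_tau.
    by apply/seteqP; split => w /=; rewrite in_itv.
  - by have := mXY measurableT _ mZ; rewrite setTI.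
  apply: filterS ae_tau_ge0 => w tau0 /= h.
  have SE : psum (seqmap tau w) n.+1 = X w + Y w by rewrite /psum big_ord_recr.
  rewrite SE in h; split => //=.
  by case/andP: h => _; apply: le_trans; rewrite lerDl; exact: tau0.
rewrite PZ -prodE.
apply: (@le_trans _ _ (\int[distribution P X]_x ((cst (v - u)%:E \_ `]-oo, v]) x))%E).
  apply: ge0_le_integral => //.
  - exact: measurable_fun_xsection.
  - apply/measurable_restrict => //; exact: measurable_cst.
  move=> x _; rewrite patchE; case: ifPn => [|].
    rewrite inE/= in_itv/= => xv.
    apply: (@le_trans _ _ (distribution P Y `]u - x, v - x])).
      apply: le_measure; rewrite ?inE//; first exact: measurable_xsection.
      move=> y; rewrite /xsection/= inE => -[_ /=]; rewrite in_itv/=.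
      by rewrite ltrBlDl lerBrDl.
    rewrite [leLHS]law//; apply: le_trans (exponential_prob_itv_le _) _.
      by rewrite lerD2r.
    by rewrite lee_fin; lra.
  rewrite notin_setE/= in_itv/= => xv.
  rewrite /= (_ : xsection Z x = set0) ?measure0//.
  by apply/seteqP; split => // y; rewrite /xsection/= inE => -[].
rewrite -integral_mkcond integral_cst//= EFinM; apply: lee_pmul => //.
  by rewrite lee_fin subr_ge0.
apply: le_trans _ (prob_psum_le n b0).
rewrite -[leLHS]/(P [set w | `]-oo, v]%classic (psum (seqmap tau w) n)]).
apply: le_measure; rewrite ?inE.
- exact: measurable_psum_tau.
- rewrite (_ : mkset _ = [set w | `]-oo, b]%classic (psum (seqmap tau w) n)]).
    exact: measurable_psum_tau.
  by apply/seteqP; split => w /=; rewrite in_itv.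
- by move=> w /=; rewrite in_itv/= => h; exact: le_trans vb.
Qed.

(** A union bound over the index of the ring; the geometric series with ratio [1 - expR (- b)] sums
    to [expR b]. *)
Lemma prob_ring_in u v b : 0 < b -> u <= v -> v <= b ->
  (P (seqmap tau @^-1` ring_in u v) <= ((v - u) * expR b)%:E)%E.
Proof.
move=> b0 uv vb; set q : R := 1 - expR (- b).
have q1 : `|q| < 1.
  have e0 := expR_gt0 (- b).
  have e1 : expR (- b) < 1 by rewrite expR_lt1 oppr_lt0.
  by rewrite ger0_norm /q; lra.
have q0 : 0 < q by rewrite subr_gt0 expR_lt1 oppr_lt0.
pose F n := [set w | `]u, v]%classic (psum (seqmap tau w) n)].
have mF n : measurable (F n) by exact: measurable_psum_tau.
have PF n : (P (F n) <= ((v - u) * q ^+ n)%:E)%E.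
  case: n => [|n].
    rewrite (_ : F 0%N = tau 0%N @^-1` `]u, v]).
      by rewrite law// expr0 mulr1 exponential_prob_itv_le.
    by apply/seteqP; split => w; rewrite /F/= /psum big_ord1.
  apply: le_trans _ (prob_psum_itv n b0 uv vb).
  by apply: le_measure; rewrite ?inE//=;
    rewrite (_ : mkset _ = F n.+1)//; apply/seteqP; split => w; rewrite /F/= in_itv.
apply: (@le_trans _ _ (\sum_(0 <= n <oo) P (F n))%E).
  apply: measure_sigma_subadditive => //.
    by apply: measurable_seqmap; exact: sigma_ring_in.
  by move=> w [n h]; exists n => //; rewrite /F/= in_itv.
apply: lime_le; first by apply: is_cvg_nneseries.
apply: nearW => n; apply: (@le_trans _ _ (\sum_(0 <= i < n) ((v - u) * q ^+ i)%:E)%E).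
  by apply: lee_sum => i _; exact: PF.
rewrite sumEFin lee_fin.
have := geometric_le_lim n (_ : 0 <= v - u) q0 q1; rewrite subr_ge0 => /(_ uv).
by rewrite {2}/q opprB addrCA subrr addr0 expRN invrK.
Qed.

(** Rings do not accumulate: the probability that all ring times stay below [b] is at most every
    power of a number smaller than 1. *)
Lemma ae_psum_unbounded b : {ae P, forall w, exists n, b < psum (seqmap tau w) n}.
Proof.
wlog b0 : b / 0 < b.
  move=> h; have := h (Num.max b 1) _; rewrite lt_max ltr01 orbT => /(_ isT).
  apply: filterS => w [n bn]; exists n; apply: le_lt_trans bn.
  by rewrite le_max lexx.
pose F n := [set w | `]-oo, b]%classic (psum (seqmap tau w) n)].
have mF n : measurable (F n) by exact: measurable_psum_tau.
exists (\bigcap_n F n); split; first exact: bigcapT_measurable.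
  apply/eqP; rewrite eq_le measure_ge0 andbT; apply/lee_addgt0Pr => e e0.
  rewrite add0e; set q : R := 1 - expR (- b).
  have q1 : `|q| < 1.
    have h0 := expR_gt0 (- b).
    have h1 : expR (- b) < 1 by rewrite expR_lt1 oppr_lt0.
    by rewrite ger0_norm /q; lra.
  have /cvgr0Pnorm_lt/(_ e e0)[n _ /(_ n (leqnn n))/= qn] := cvg_expr q1.
  apply: (@le_trans _ _ (P (F n))).
    apply: le_measure; rewrite ?inE//; first exact: bigcapT_measurable.
    by move=> w; exact.
  apply: (@le_trans _ _ ((q ^+ n.+1)%:E)).
    apply: le_trans _ (prob_psum_le n b0); apply: le_measure; rewrite ?inE//.
    exact: (mF n).
  rewrite lee_fin; apply: le_trans (ler_norm _) _; rewrite exprS normrM.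
  by apply: le_trans (ltW qn); rewrite ler_piMl// ltW.
move=> w /= h n _; rewrite /F/= in_itv/= leNgt; apply/negP => bn.
by apply: h; exists n.
Qed.

End exponential_sequence.

(** Allows one law of ring patterns to serve for all sites and for the probability spaces of
    different densities. *)
Lemma exponential_law_unique (R : realType) d1 (T1 : measurableType d1)
    (P1 : probability T1 R) (tau1 : nat -> {RV P1 >-> R})
    d2 (T2 : measurableType d2) (P2 : probability T2 R)
    (tau2 : nat -> {RV P2 >-> R}) :
  iid_exponential tau1 -> iid_exponential tau2 ->
  forall E, <<s @all_cylinders R >> E ->
  P1 (seqmap tau1 @^-1` E) = P2 (seqmap tau2 @^-1` E).
Proof.
move=> h1 h2 E; apply: preimage_measure_unique.
- exact: all_cylindersI.
- by exists 0%N; exact: cylindersT.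
- exact: measurable_seqmap_cylinder.
- exact: measurable_seqmap_cylinder.
- by rewrite ltey_eq fin_num_measure.
- move=> _ [N [A [mA AT ->]]]; rewrite !(seqmap_cylinder _ AT).
  apply: etrans (proj2 h1 N A mA) _; apply: etrans (esym (proj2 h2 N A mA)).
  apply: eq_bigr => n _.
  by rewrite (proj1 h1)// (proj1 h2).
Qed.

(** * Independence across sites *)

Lemma probability_partition d (T : measurableType d) (R : realType)
    (P : probability T R) (V : finType) (X : T -> V) (H : set T) :
  measurable H -> (forall v, measurable (X @^-1` [set v])) ->
  P H = (\sum_v P (H `&` X @^-1` [set v]))%E.
Proof.
move=> mH mX; transitivity (P (\bigcup_(v in [set` index_enum V]) (H `&` X @^-1` [set v]))).
  congr (P _); apply/seteqP; split => [w Hw|w [v _ []//]].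
  by exists (X w) => //=; exact: mem_index_enum.
apply: etrans (measure_fin_bigcup _ _ _ _) _.
- exact: finite_seq.
- by move=> v v' _ _ [w [[_ <-] [_ <-]]].
- by move=> v _; exact: measurableI.
- by rewrite -fsbig_seq// index_enum_uniq.
Qed.

Section sites.
Context d (T : measurableType d) (R : realType) (P : probability T R).
Variables (xi : site -> {RV P >-> bool}) (tau : site -> nat -> {RV P >-> R}).
Hypothesis tau_law : forall x n A, measurable A ->
  distribution P (tau x n) A = exponential_prob 1 A.
Hypothesis indep : mutually_independent P (sources xi tau).
Implicit Types (B : site -> set bool) (E : site -> set (nat -> R)) (s : seq site).

Let source_xi x (B : set bool) : sources xi tau (inl x) (xi x @^-1` B).
Proof. by exists B => //; rewrite setTI. Qed.

Let source_tau x n (A : set R) : measurable A ->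
  sources xi tau (inr (x, n)) (tau x n @^-1` A).
Proof. by exists A => //; rewrite setTI. Qed.

Lemma iid_clock x : iid_exponential (tau x).
Proof.
split=> [n A mA|N A mA]; first exact: tau_law.
pose C (i : site + site * nat) := if i is inr (_, n) then tau x n @^-1` A n else setT.
have := @indep [seq inr (x, n) | n <- iota 0 N] C.
rewrite big_map -[in iota _ _](subn0 N) -/(index_iota 0 N) big_mkord => <-.
- congr (P _); apply/seteqP; split => w h.
    by move=> i /= /mapP[n]; rewrite mem_index_iota => nN ->; exact: h.
  move=> n /= nN; apply: (h (inr (x, n))) => /=.
  by apply/mapP; exists n => //; rewrite mem_index_iota.
- by rewrite map_inj_uniq ?iota_uniq// => m n [].
- by move=> i /mapP[n _ ->]; exact: source_tau.
Qed.

Definition site_event B E x := xi x @^-1` B x `&` seqmap (tau x) @^-1` E x.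

Lemma measurable_xi x (B : set bool) : measurable (xi x @^-1` B).
Proof. by rewrite -[X in measurable X]setTI; exact: measurable_funP. Qed.

Lemma measurable_site_event B E x : <<s @all_cylinders R >> (E x) ->
  measurable (site_event B E x).
Proof.
by move=> sE; apply: measurableI; [exact: measurable_xi|exact: measurable_seqmap].
Qed.

Let factorizes B E s :=
  P (\bigcap_(x in [set` s]) site_event B E x) =
  (\prod_(x <- s) (P (xi x @^-1` B x) * P (seqmap (tau x) @^-1` E x)))%E.

Let factorizes_perm B E s s' : perm_eq s s' -> factorizes B E s -> factorizes B E s'.
Proof.
move=> ss'; rewrite /factorizes (perm_big _ ss')/= => <-; congr (P _).
by apply/seteqP; split => w h x /= xs; apply: h; rewrite /= (perm_mem ss') in xs *.
Qed.

Let factorizes_cylinders B E s : uniq s -> (forall x, all_cylinders (E x)) ->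
  factorizes B E s.
Proof.
move=> us /choice[N /choice[A EA]].
pose M := (\max_(x <- s) N x)%N.
have AT x n : x \in s -> (M <= n)%N -> A x n = setT.
  move=> xs Mn; have [_ + _] := EA x; apply; apply: leq_trans Mn.
  by rewrite /M (big_rem x)//= leq_maxl.
have mA x n : measurable (A x n) by have [] := EA x.
pose C (i : site + site * nat) := match i with
  | inl x => xi x @^-1` B x | inr (x, n) => tau x n @^-1` A x n end.
pose J := map inl s ++ [seq inr u | u <- [seq (x, n) | x <- s, n <- iota 0 M]].
have cylE x : x \in s -> seqmap (tau x) @^-1` E x = \bigcap_(n in `I_M) tau x n @^-1` A x n.
  by move=> xs; have [_ _ ->] := EA x; apply: seqmap_cylinder => n; exact: AT.
rewrite /factorizes.
have -> : \bigcap_(x in [set` s]) site_event B E x = \bigcap_(i in [set` J]) C i.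
  apply/seteqP; split => w h.
    move=> i; rewrite /= mem_cat => /orP[/mapP[x xs ->]|].
      by have [] := h x xs.
    move=> /mapP[_ /allpairsP[[x n] [/= xs nM ->]] ->] /=.
    have [_] := h x xs; rewrite cylE//; apply; move: nM.
    by rewrite mem_iota add0n.
  move=> x /= xs; split.
    by apply: (h (inl x)); rewrite /= mem_cat map_f.
  rewrite cylE// => n /= nM; apply: (h (inr (x, n))); rewrite /= mem_cat.
  apply/orP; right; apply: map_f; apply/allpairsP; exists (x, n).
  by rewrite mem_iota.
rewrite indep.
- rewrite big_cat !big_map big_allpairs/= -big_split/= big_seq [RHS]big_seq.
  apply: eq_bigr => x xs; congr (_ * _)%E.
  rewrite cylE// (proj2 (iid_clock x))//.
  by rewrite -[in iota _ _](subn0 M) -/(index_iota 0 M) big_mkord.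
- rewrite cat_uniq map_inj_uniq ?us; last by move=> ? ? [].
  rewrite map_inj_uniq; last by move=> ? ? [].
  apply/andP; split=> //; apply/andP; split.
    by apply/hasPn => _ /mapP[u _ ->]; apply/negP => /mapP[].
  by apply: allpairs_uniq; rewrite ?iota_uniq// => -[? ?] [? ?].
- move=> i; rewrite mem_cat => /orP[/mapP[x _ ->]|/mapP[[x n] _ ->]].
    exact: source_xi.
  exact: source_tau.
Qed.

Let setx E x (F : set (nat -> R)) := fun y => if y == x then F else E y.

(** Cylinder events are upgraded to general ones site by site: with the other sites fixed, the
    formula for cylinders at [x] is an independence statement, which [independent_sigma] extends. *)
Let factorizes_sigma B E s s' : uniq (s ++ s') ->
  (forall x, <<s @all_cylinders R >> (E x)) ->
  (forall x, x \notin s -> all_cylinders (E x)) ->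
  factorizes B E (s ++ s').
Proof.
elim: s s' E => [|x s IHs] s' E us sE cE.
  by apply: factorizes_cylinders => // x; exact: cE.
have [xs us'] : x \notin s ++ s' /\ uniq (s ++ s') by move: us => /= /andP[].
pose D := xi x @^-1` B x `&` \bigcap_(y in [set` s ++ s']) site_event B E y.
have mD : measurable D.
  apply: measurableI; first exact: measurable_xi.
  apply: fin_bigcap_measurable => [|y _]; first exact: finite_seq.
  exact: measurable_site_event.
pose Q := (P (xi x @^-1` B x) * \prod_(y <- s ++ s')
  (P (xi y @^-1` B y) * P (seqmap (tau y) @^-1` E y)))%E.
have splitE F : \bigcap_(y in [set` x :: s ++ s']) site_event B (setx E x F) y =
    seqmap (tau x) @^-1` F `&` D.
  apply/seteqP; split => w.
    move=> h; have := h x (mem_head _ _); rewrite /site_event/setx eqxx => -[Bx Fx].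
    split => //; split => // y /= ys; have := h y; rewrite /= inE ys orbT.
    by rewrite /site_event /setx; case: eqP ys xs => [->->//|_ _ _]; exact.
  move=> [Fx [Bx h]] y /=; rewrite inE /site_event /setx.
  by case: eqP => [->//|_ /= ys]; exact: h.
have prodE F : (\prod_(y <- x :: s ++ s') (P (xi y @^-1` B y) *
    P (seqmap (tau y) @^-1` (setx E x F) y)))%E = (P (seqmap (tau x) @^-1` F) * Q)%E.
  rewrite big_cons /setx eqxx /Q muleCA muleA; congr (_ * _)%E.
  apply: eq_big_seq => y ys; case: eqP ys xs => [->->//|//].
have cyl F : all_cylinders F -> P (seqmap (tau x) @^-1` F `&` D) =
    (P (seqmap (tau x) @^-1` F) * Q)%E.
  move=> cF; rewrite -splitE -prodE.
  (* Moving [x] into the second block, where cylinders are required, makes the induction hypothesis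
     applicable. *)
  apply: (@factorizes_perm _ _ (s ++ x :: s')); first by rewrite -[x :: s']cat1s perm_catCA.
  apply: IHs.
  - rewrite (@perm_uniq _ _ (x :: s ++ s')) ?us//; last by rewrite -[x :: s']cat1s perm_catCA.
  - by move=> y; rewrite /setx; case: eqP => // _; exact: sub_sigma_algebra.
  - move=> y ys; rewrite /setx; case: eqP => // /eqP yx.
    by apply: cE; rewrite inE negb_or yx.
(* Taking [F = setT] identifies [Q] as the probability of [D]. *)
have PD : P D = Q.
  have := cyl setT; rewrite preimage_setT setTI probability_setT mul1e; apply.
  by exists 0%N; exact: cylindersT.
rewrite /factorizes (_ : E = setx E x (E x)); last first.
  by apply/funext => y; rewrite /setx; case: eqP => // ->.
rewrite cat_cons splitE prodE -PD; apply: (independent_sigma (@all_cylindersI R)) => //.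
- by exists 0%N; exact: cylindersT.
- exact: measurable_seqmap_cylinder.
- by move=> F cF; rewrite PD; exact: cyl.
Qed.

Lemma sites_independent B E s : uniq s ->
  (forall x, <<s @all_cylinders R >> (E x)) ->
  P (\bigcap_(x in [set` s]) site_event B E x) =
  (\prod_(x <- s) (P (xi x @^-1` B x) * P (seqmap (tau x) @^-1` E x)))%E.
Proof.
(* Off [s] the events are replaced by [setT], so that they are cylinders there. *)
move=> us sE; pose E' x := if x \in s then E x else setT.
have := @factorizes_sigma B E' s [::]; rewrite cats0 => /(_ us).
rewrite /factorizes; under [in X in _ -> _ -> _ = X]eq_big_seq => x xs do rewrite /E' xs.
rewrite (_ : \bigcap_(x in _) site_event B E' x =
             \bigcap_(x in [set` s]) site_event B E x); last first.
  by apply: eq_bigcapr => x /= xs; rewrite /site_event /E' xs.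
apply.
- move=> x; rewrite /E'; case: ifP => // _.
  by apply: sub_sigma_algebra; exists 0%N; exact: cylindersT.
- by move=> x /negPf xs; rewrite /E' xs; exists 0%N; exact: cylindersT.
Qed.

End sites.

(** * Ring patterns and the law of the data at finitely many sites *)

Definition pattern (R : realType) (g : nat -> R) (n : nat) (f : nat -> R) :
    n.-tuple bool :=
  [tuple `[< ring_in (g j) (g j.+1) f >] | j < n].

Lemma nth_pattern (R : realType) (g : nat -> R) n f j : (j < n)%N ->
  nth false (pattern g n f) j = `[< ring_in (g j) (g j.+1) f >].
Proof. by move=> jn; rewrite -[j]/(val (Ordinal jn)) -tnth_nth tnth_mktuple. Qed.

Lemma sigma_pattern (R : realType) (g : nat -> R) n (rho : n.-tuple bool) :
  <<s @all_cylinders R >> [set f | pattern g n f = rho].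
Proof.
pose F j := if nth false rho j then ring_in (g j) (g j.+1) else ~` ring_in (g j) (g j.+1).
rewrite (_ : mkset _ = \bigcap_(j in `I_n) F j).
  apply: (@bigcap_measurableType _ (g_sigma_algebraType (@all_cylinders R))) => j _.
  have mr := sigma_ring_in (g j) (g j.+1).
  rewrite /F; case: nth => //.
  exact: (@measurableC _ (g_sigma_algebraType (@all_cylinders R))).
apply/seteqP; split => [f /= fr j /= jn|f /= h].
  by rewrite /F -fr nth_pattern//; case: asboolP.
apply/val_inj/(@eq_from_nth _ false); first by rewrite !size_tuple.
move=> j; rewrite size_tuple => jn; rewrite nth_pattern//.
have := h j jn; rewrite /F; case: nth => h'; first exact/asboolP.
exact/asboolPn.
Qed.

Section data.
Context d (T : measurableType d) (R : realType) (P : probability T R).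
Variables (xi : site -> {RV P >-> bool}) (tau : site -> nat -> {RV P >-> R}).
Variables (p : R) (g : nat -> R) (n : nat) (mu : n.-tuple bool -> R).
Hypothesis p01 : 0 <= p <= 1.
Hypothesis xi_law : forall x A, measurable A ->
  distribution P (xi x) A = bernoulli_prob p A.
Hypothesis tau_law : forall x k A, measurable A ->
  distribution P (tau x k) A = exponential_prob 1 A.
Hypothesis indep : mutually_independent P (sources xi tau).
Hypothesis muE : forall x rho,
  P (seqmap (tau x) @^-1` [set f | pattern g n f = rho]) = (mu rho)%:E.

Definition datum_of (w : T) (x : site) : datum n :=
  (xi x w, pattern g n (seqmap (tau x) w)).

Lemma preimage_datum_of x (v : datum n) :
  (datum_of ^~ x) @^-1` [set v] =
  xi x @^-1` [set v.1] `&` seqmap (tau x) @^-1` [set f | pattern g n f = v.2].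
Proof.
case: v => b rho; apply/seteqP; split => w /=; first by move=> [<- <-].
by rewrite /datum_of => -[-> ->].
Qed.

Lemma measurable_datum_of x (v : datum n) : measurable ((datum_of ^~ x) @^-1` [set v]).
Proof.
rewrite preimage_datum_of; apply: measurableI; first exact: measurable_xi.
by apply: measurable_seqmap; exact: sigma_pattern.
Qed.

Lemma prob_xi x b : P (xi x @^-1` [set b]) = (if b then p else 1 - p)%:E.
Proof.
rewrite -[LHS]/(distribution P (xi x) [set b]) xi_law//.
rewrite bernoulli_probE//; case: b; rewrite !diracE.
  by rewrite mem_set// memNset//= mule1 mule0 adde0.
by rewrite memNset// mem_set//= mule1 mule0 add0e.
Qed.

Lemma prob_data (s : seq site) (v : site -> datum n) : uniq s ->
  P (\bigcap_(x in [set` s]) (datum_of ^~ x) @^-1` [set v x]) =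
  (\prod_(x <- s) weight p mu (v x))%:E.
Proof.
move=> us; under eq_bigcapr => x _ do rewrite preimage_datum_of.
pose B x := [set (v x).1]; pose E x := [set f | pattern g n f = (v x).2].
rewrite -[LHS]/(P (\bigcap_(x in [set` s]) site_event xi tau B E x)).
rewrite sites_independent//; last by move=> x; exact: sigma_pattern.
by rewrite -prodEFin; apply: eq_bigr => x _; rewrite prob_xi muE -EFinM.
Qed.

Definition sample (s : seq site) (d0 : site -> datum n) (w : T) : site -> datum n :=
  fun x => if x \in s then datum_of w x else d0 x.

Lemma sample_cons x (s : seq site) d0 w : x \notin s ->
  sample (x :: s) d0 w = sample s (upd d0 x (datum_of w x)) w.
Proof.
move=> xs; apply/funext => y; rewrite /sample /upd inE.
by case: eqP => [->|//]; rewrite (negPf xs).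
Qed.

Lemma measurable_sample (s : seq site) (f : (site -> datum n) -> bool) d0 : uniq s ->
  measurable [set w | f (sample s d0 w)].
Proof.
elim: s d0 => [d0 _|x s IHs d0 /=/andP[xs us]].
  case E : (f d0).
    by rewrite (_ : mkset _ = setT)//; apply/seteqP; split.
  by rewrite (_ : mkset _ = set0)//; apply/seteqP; split => // w /=; rewrite /sample E.
rewrite (_ : mkset _ = \bigcup_(v in [set` index_enum (datum n)])
   ((datum_of ^~ x) @^-1` [set v] `&` [set w | f (sample s (upd d0 x v) w)])).
  apply: fin_bigcup_measurable => [|v _]; first exact: finite_seq.
  by apply: measurableI; [exact: measurable_datum_of|exact: IHs].
apply/seteqP; split => w /=.
  rewrite sample_cons// => fw; exists (datum_of w x) => //=; exact: mem_index_enum.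
by move=> [v _ [/= <-]]; rewrite sample_cons.
Qed.

Lemma prob_sample (s : seq site) (f : (site -> datum n) -> bool) d0 : uniq s ->
  P [set w | f (sample s d0 w)] =
  (expect (weight p mu) s (fun d => (f d)%:R) d0)%:E.
Proof.
move=> us.
(* The statement is strengthened by prescribing the data on a further list [t]; in the induction
   each site moves from [s] to [t] with its value fixed. *)
suff h : forall t v d1, uniq (s ++ t) ->
    P (\bigcap_(x in [set` t]) (datum_of ^~ x) @^-1` [set v x] `&`
       [set w | f (sample s d1 w)]) =
    (\prod_(x <- t) weight p mu (v x) *
     expect (weight p mu) s (fun d => (f d)%:R) d1)%:E.
  have := h [::] (fun x => d0 x) d0; rewrite cats0 => /(_ us).
  by rewrite big_nil mul1r set_nil bigcap_set0 setTI; exact.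
elim: s us => [_|x s IHs /= /andP[xs us]] t v d1.
  move=> ut; rewrite [expect _ _ _ _]/=; case E : (f d1).
    rewrite (_ : [set _ | true] = setT); last by apply/seteqP; split.
    by rewrite setIT mulr1 prob_data.
  rewrite (_ : [set _ | false] = set0); last by apply/seteqP; split.
  by rewrite setI0 mulr0 measure0.
rewrite mem_cat => /andP[/norP[_ xt] ut].
set G := \bigcap_(y in _) _.
have mG : measurable G.
  apply: fin_bigcap_measurable => [|y _]; first exact: finite_seq.
  exact: measurable_datum_of.
rewrite (probability_partition _ (measurableI _ _ mG (measurable_sample _ _ _))
  (measurable_datum_of x)); last by rewrite /= xs.
rewrite mulr_sumr -sumEFin; apply: eq_bigr => u _.
have := IHs us (x :: t) (upd v x u) (upd d1 x u).
rewrite (@perm_uniq _ _ (x :: s ++ t)); last by rewrite -[x :: t]cat1s perm_catCA.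
rewrite /= mem_cat (negPf xs) (negPf xt) => /(_ ut).
have ux : upd v x u x = u by rewrite /upd eqxx.
rewrite big_cons ux.
rewrite (eq_big_seq (fun y => weight p mu (v y))); last first.
  by move=> y yt; rewrite /upd; case: eqP yt xt => [->->|].
rewrite -mulrA mulrCA => <-; congr (P _); apply/seteqP; split => w.
  move=> [[Gw]]; rewrite /= sample_cons// => fw <-; split => //.
  move=> y /=; rewrite inE /upd; case: eqP => [->//|_ /= yt]; exact: Gw.
move=> [h fw]; have xw : datum_of w x = u.
  by have := h x (mem_head _ _); rewrite /upd eqxx.
split; last exact: xw.
split; last by rewrite /= sample_cons// xw.
move=> y /= yt; have := h y; rewrite /= inE yt orbT /upd.
by case: eqP yt xt => [->->//|_ _ _]; exact.
Qed.

Definition rings_at (w : T) (x : site) (j : nat) : bool :=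
  `[< ring_in (g j) (g j.+1) (seqmap (tau x) w) >].

(** The sites of the chain are distinct, so its ringing events are independent and their
    probabilities multiply. *)
Lemma prob_chain (c : seq (site * nat)) (q : R) : uniq (map fst c) ->
  (forall u, u \in c ->
    (P (seqmap (tau u.1) @^-1` ring_in (g u.2) (g u.2.+1)) <= q%:E)%E) ->
  (P [set w | all (fun u => rings_at w u.1 u.2) c] <= (q ^+ size c)%:E)%E.
Proof.
(* [i x] recovers the step paired with the site [x] in [c], unambiguous as sites do not repeat; the
   default is irrelevant on [c]. *)
move=> uc hq; pose i x := (nth (x, 0%N) c (index x (map fst c))).2.
have ic u : u \in c -> i u.1 = u.2.
  move=> cu; have iu := index_uniq; rewrite /i.
  have cs : (index u c < size c)%N by rewrite index_mem.
  have -> : index u.1 (map fst c) = index u c.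
    rewrite -[in LHS](nth_index (u.1, 0%N) cu) -(nth_map _ u.1)// index_uniq//.
    by rewrite size_map.
  by rewrite nth_index.
pose E x := ring_in (g (i x)) (g (i x).+1).
rewrite (_ : mkset _ =
  \bigcap_(x in [set` map fst c]) site_event xi tau (fun=> setT) E x); last first.
  apply/seteqP; split => w /= h.
    move=> x /= /mapP[u cu ->]; split => //; rewrite /E (ic _ cu) /=.
    by have /asboolP := allP h _ cu.
  apply/allP => u cu; apply/asboolP.
  by have [_] := h _ (map_f _ cu); rewrite /E /= (ic _ cu).
rewrite sites_independent//; last by move=> x; exact: sigma_ring_in.
rewrite big_map.
have hE u : u \in c -> (P (seqmap (tau u.1) @^-1` E u.1) <= q%:E)%E.
  by move=> cu; rewrite /E (ic _ cu); exact: hq.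
clearbody E; clear uc hq i ic; elim: c hE => [|u c IHc] hE; first by rewrite big_nil.
rewrite big_cons /= exprS EFinM; apply: lee_pmul => //.
- by rewrite mule_ge0.
- by apply: prode_ge0 => v _; rewrite mule_ge0.
- by rewrite preimage_setT probability_setT mul1e; apply: hE; exact: mem_head.
- by apply: IHc => v vc; apply: hE; rewrite inE vc orbT.
Qed.

End data.

(** * Discretization of the continuous-time process *)

Lemma psum_mono (R : realType) (f : nat -> R) m n : (forall k, 0 <= f k) ->
  (m <= n)%N -> psum f m <= psum f n.
Proof.
move=> f0; elim: n => [|n IHn]; first by rewrite leqn0 => /eqP->.
rewrite leq_eqVlt => /predU1P[->//|]; rewrite ltnS => /IHn /le_trans; apply.
by rewrite /psum [leRHS]big_ord_recr/= lerDl.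
Qed.

Lemma eq_clock_ring (R : realType) (f : nat -> R) u v :
  (forall r, u < r -> r <= v -> ~ rings f r) <-> ~ ring_in u v f.
Proof.
split=> [h [n /andP[un nv]]|h r ur rv [n _ nr]]; first by apply: h un nv _; exists n.
by apply: h; exists n; rewrite /psum nr ur.
Qed.

Lemma ring_inW (R : realType) (f : nat -> R) u u' v v' :
  u' <= u -> v <= v' -> ring_in u v f -> ring_in u' v' f.
Proof.
by move=> uu vv [n /andP[un nv]]; exists n; rewrite (le_lt_trans uu un) (le_trans nv vv).
Qed.

(* Several rings of x in a cell act as one, as majority is idempotent while the
   neighbors of x are constant. *)
Lemma cell_step (R : realType) (f : site -> nat -> R) xi (eta : R -> config) u v x :
  majority_path (fun x => rings (f x)) xi eta -> 0 <= u -> u <= v ->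
  (forall k, 0 <= f x k) -> (exists n, v < psum (f x) n) ->
  (ring_in u v (f x) -> {in neighbors x, forall y, ~ ring_in u v (f y)}) ->
  eta v x = if `[< ring_in u v (f x) >] then majority (eta u) x else eta u x.
Proof.
move=> [_ const jump] u0 uv f0 [N vN] quietn.
case: asboolP => [rx|/eq_clock_ring]; last exact: const.
have nbr s : u <= s -> s <= v -> {in neighbors x, eta s =1 eta u}.
  move=> us sv y yx; apply: const => //; apply/eq_clock_ring => ry.
  exact: (quietn rx _ yx) (ring_inW (lexx u) sv ry).
(* Induction on an index [n] whose ring time exceeds [s], that is, on a bound for the number of
   rings of [x] up to [s]. *)
suff claim n s : u <= s -> s <= v -> s < psum (f x) n ->
    eta s x = if `[< ring_in u s (f x) >] then majority (eta u) x else eta u x.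
  by rewrite (claim N v)// asboolT.
elim: n s => [|n IHn] s us sv sn.
  have nr : ~ ring_in u s (f x).
    move=> [k /andP[_]]; rewrite leNgt => /negP; apply.
    exact: lt_le_trans sn (psum_mono f0 (leq0n k)).
  by rewrite asboolF//; apply: const => //; exact/eq_clock_ring.
have [|ns] := ltP s (psum (f x) n); first exact: IHn.
have noring r : psum (f x) n <= r -> ~ ring_in r s (f x).
  move=> nr [k /andP[rk ks]]; have [kn|nk] := leqP k n.
    by have := psum_mono f0 kn; rewrite leNgt (le_lt_trans nr rk).
  by have := psum_mono f0 nk; rewrite leNgt (le_lt_trans ks sn).
have [nu|un] := leP (psum (f x) n) u.
  rewrite asboolF; last exact: noring.
  by apply: const => //; apply/eq_clock_ring; exact: noring.
rewrite asboolT; last by exists n; rewrite un ns.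
set r := psum (f x) n in un ns noring IHn *.
have r0 : 0 < r by exact: le_lt_trans un.
have /(filterI (nbhs_left_gt un))/(filterI (nbhs_left_lt r)) : \forall s \near r^'-,
    eta r x = majority (eta s) x by apply: jump => //; exists n.
(* A time [s'] after [u] and just before the ring at [r] realizes the left limit; the induction
   hypothesis describes the opinion there, and idempotence absorbs the ring at [r]. *)
move=> /filter_ex[s' [/= s'r [us' E]]].
have s'v : s' <= v by exact: le_trans (ltW s'r) (le_trans ns sv).
rewrite (const x r s) ?(ltW r0)//; last by apply/eq_clock_ring; exact: noring.
rewrite E; apply: majority_id; first exact: nbr (ltW us') s'v.
by rewrite (IHn s' (ltW us'))//; case: ifP; [right|left].
Qed.

Lemma sum_const_seq (R : pzRingType) (I : Type) (s : seq I) (x : R) :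
  \sum_(i <- s) x = (size s)%:R * x.
Proof.
elim: s => [|i s IHs]; first by rewrite big_nil mul0r.
by rewrite big_cons IHs mulrS mulrDl mul1r.
Qed.

(** * Agreement with the discrete dynamics outside a bad event *)

Section approximation.
Context d (T : measurableType d) (R : realType) (P : probability T R).
Variables (xi : site -> {RV P >-> bool}) (tau : site -> nat -> {RV P >-> R}).
Variables (eta : R -> site -> {RV P >-> bool}) (g : nat -> R) (n : nat).
Hypothesis tau_law : forall x k A, measurable A ->
  distribution P (tau x k) A = exponential_prob 1 A.
Hypothesis indep : mutually_independent P (sources xi tau).
Hypothesis pathP : {ae P, forall w,
  majority_path (fun x => rings (fun k => tau x k w)) (fun x => xi x w)
    (fun t x => eta t x w)}.
Hypothesis g0 : g 0%N = 0.
Hypothesis g_mono : forall j, (j < n)%N -> g j <= g j.+1.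

Lemma ae_forall_count (I : countType) (Q : I -> T -> Prop) :
  (forall i, {ae P, forall w, Q i w}) -> {ae P, forall w, forall i, Q i w}.
Proof.
move=> aeQ.
have : {ae P, forall w, forall k, if unpickle k is Some i then Q i w else True}.
  apply: ae_foralln => k; case: (unpickle k) => [i|]; first exact: aeQ.
  exact: aeW.
by apply: filterS => w h i; have := h (pickle i); rewrite pickleK.
Qed.

(** Both obstructions are lists of pairs (site, cell) that all ring: two neighbors in the same cell,
    or a chain of distinct sites reaching [B]. One union bound covers them. *)
Definition bad_chains (L B : seq site) (k l : nat) : seq (seq (site * nat)) :=
  [seq [:: (u.1, j); (u.2, j)] |
     u <- flatten [seq [seq (x, y) | y <- neighbors x] | x <- L], j <- iota 0 n] ++
  flatten [seq [seq c <- chains k x l | uniq (map fst c)] | x <- B].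

Definition bad_event (L B : seq site) (k l : nat) : set T :=
  [set w | has (fun c => all (fun u => rings_at tau g w u.1 u.2) c) (bad_chains L B k l)].

Let g_ge0 j : (j <= n)%N -> 0 <= g j.
Proof.
elim: j => [|j IHj] jn; first by rewrite g0.
by apply: le_trans (g_mono jn); exact/IHj/ltnW.
Qed.

Let g_le j i : (j <= i)%N -> (i <= n)%N -> g j <= g i.
Proof.
elim: i => [|i IHi]; first by rewrite leqn0 => /eqP->.
rewrite leq_eqVlt => /predU1P[->//|]; rewrite ltnS => ji ni.
by apply: le_trans (g_mono ni); exact/IHi/ltnW.
Qed.

(** Off the bad event no neighbor rings in the same cell as a site of [L], so [cell_step] makes the
    process at grid times obey the discrete recursion on [L]. A disagreement in [B] would then
    produce a bad chain by [disagreement_chain]. *)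
Lemma ae_agreement (L B : seq site) (k l : nat) (d0 : site -> datum n) :
  (l <= n)%N -> {in B, forall x, {subset site_ball k x <= L}} ->
  {ae P, forall w, ~ bad_event L B k l w ->
    {in B, forall x, eta (g l) x w = run (fun=> l) (sample xi tau g L d0 w) x}}.
Proof.
move=> ln BL.
have aetau : {ae P, forall w, forall x, (forall k, 0 <= tau x k w) /\
    (exists i, g n < psum (seqmap (tau x) w) i)}.
  apply: ae_forall_count => x.
  have h := iid_clock tau_law indep x.
  by apply: filterS2 (ae_tau_ge0 h) (ae_psum_unbounded h (g n)).
apply: filterS2 aetau pathP => w tauw path nbad x xB.
pose e j := (fun y => eta (g j) y w) : config.
pose dat := sample xi tau g L d0 w.
pose F := dyn (fun y => (dat y).1) (fun y j => nth false (dat y).2 j).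
have datL y : y \in L -> dat y = datum_of xi tau g n w y.
  by move=> yL; rewrite /dat /sample yL.
rewrite /run dyn_stop// -/(F l).
apply/eqP; rewrite -[_ == _]/(e l x == F l x); apply/negPn/negP => dis.
apply: (nbad); have [] := @disagreement_chain (mem L) (rings_at tau g w) e F n _ _ _
    k x l ln _ dis.
- by move=> y yL; rewrite /F /= datL//= /e g0; have [-> _ _] := path.
- move=> y j yL jn; have [tau0 [N gN]] := tauw y.
  have jN : exists i, g j.+1 < psum (seqmap (tau y) w) i.
    by exists N; apply: le_lt_trans gN; exact: g_le.
  rewrite /e (cell_step path (g_ge0 (ltnW jn)) (g_mono jn) tau0 jN)//.
  move=> ry z zy rz; apply: nbad; rewrite /bad_event /= has_cat; apply/orP; left.
  apply/hasP; exists [:: (y, j); (z, j)]; last by rewrite /= /rings_at !asboolT.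
  apply/allpairsP; exists ((y, z), j); rewrite mem_iota; split => //.
  by apply/flatten_mapP; exists y => //; apply/mapP; exists z.
- by move=> y j yL jn; rewrite /= /F/= datL//= nth_pattern.
- by apply/allP; exact: BL.
move=> c cc /andP[cu cr]; rewrite /bad_event /= has_cat; apply/orP; right.
apply/hasP; exists c => //; apply/flatten_mapP; exists x => //.
by rewrite mem_filter cu.
Qed.

Lemma measurable_all_rings (c : seq (site * nat)) :
  measurable [set w | all (fun u => rings_at tau g w u.1 u.2) c].
Proof.
rewrite (_ : mkset _ = \bigcap_(u in [set` c])
    seqmap (tau u.1) @^-1` ring_in (g u.2) (g u.2.+1)).
  apply: fin_bigcap_measurable => [|u _]; first exact: finite_seq.
  by apply: measurable_seqmap; exact: sigma_ring_in.
apply/seteqP; split => w /= h; first by move=> u /= /(allP h)/asboolP.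
by apply/allP => u /h ?; exact/asboolP.
Qed.

Lemma measurable_has (I : eqType) (F : I -> T -> bool) (s : seq I) :
  (forall i, measurable [set w | F i w]) -> measurable [set w | has (F^~ w) s].
Proof.
move=> mF; rewrite (_ : mkset _ = \bigcup_(i in [set` s]) [set w | F i w]).
  by apply: fin_bigcup_measurable => [|i _]; [exact: finite_seq|exact: mF].
apply/seteqP; split => w /=; first by move=> /hasP[i is_ Fi]; exists i.
by move=> [i is_ Fi]; apply/hasP; exists i.
Qed.

Lemma prob_has (I : eqType) (F : I -> T -> bool) (b : I -> R) (s : seq I) :
  (forall i, measurable [set w | F i w]) ->
  (forall i, i \in s -> (P [set w | F i w] <= (b i)%:E)%E) ->
  (P [set w | has (F^~ w) s] <= (\sum_(i <- s) b i)%:E)%E.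
Proof.
move=> mF; elim: s => [|i s IHs] hb.
  by rewrite big_nil (_ : mkset _ = set0) ?measure0//; apply/seteqP; split.
rewrite (_ : mkset _ = [set w | F i w] `|` [set w | has (F^~ w) s]); last first.
  by apply/seteqP; split => w /=; [move/orP|move=> h; exact/orP].
apply: le_trans (measureU2 _ (mF i) (measurable_has _ mF)) _.
rewrite big_cons EFinD; apply: leeD; first by apply: hb; exact: mem_head.
by apply: IHs => j js; apply: hb; rewrite inE js orbT.
Qed.

Lemma measurable_bad_event L B k l : measurable (bad_event L B k l).
Proof. by apply: measurable_has; exact: measurable_all_rings. Qed.

Lemma bad_chainsP L B k l c : (l <= n)%N -> c \in bad_chains L B k l ->
  uniq (map fst c) /\ all (fun u => u.2 < n)%N c.
Proof.
move=> ln; rewrite mem_cat => /orP[|].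
  move=> /allpairsP[[[x y] j] [/= xy]]; rewrite mem_iota /= add0n => jn ->.
  move: xy => /flatten_mapP[z _ /mapP[t tz [-> ->]]]; rewrite /= jn inE andbT.
  split=> //; apply: contraTN tz => /eqP->; rewrite mem_neighbors.
  by rewrite /adjacent !subrr.
move=> /flatten_mapP[x _]; rewrite mem_filter => /andP[-> /chain_lt cl].
by split=> //; apply: sub_all cl => u /leq_trans; exact.
Qed.

(** Union bound: at most four neighbor pairs per site of [L] and cell, each of probability at most
    [q ^+ 2], and the chains counted by [size_chains], each at most [q ^+ k.+1]. *)
Lemma prob_bad_event (L B : seq site) (k l : nat) (q : R) : 0 <= q -> (l <= n)%N ->
  (forall x j, (j < n)%N ->
    (P (seqmap (tau x) @^-1` ring_in (g j) (g j.+1)) <= q%:E)%E) ->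
  (P (bad_event L B k l) <=
    ((size L * 4 * n)%:R * q ^+ 2 +
     (size B * (4 ^ k * 'C(n, k.+1)))%:R * q ^+ k.+1)%:E)%E.
Proof.
move=> q0 ln hq; apply: le_trans (prob_has (b := fun c => q ^+ size c) _ _) _.
- exact: measurable_all_rings.
- move=> c /(bad_chainsP ln)[uc /allP cn].
  by apply: (prob_chain tau_law indep) => // u uc'; apply: hq; exact: cn.
rewrite lee_fin big_cat/=; apply: lerD.
  rewrite big_allpairs_dep big_flatten big_map.
  rewrite (eq_bigr (fun=> (4 * n)%:R * q ^+ 2)); last first.
    move=> x _; rewrite big_map.
    rewrite (eq_bigr (fun=> n%:R * q ^+ 2)); last first.
      by move=> y _; rewrite /= sum_const_seq size_iota.
    by rewrite sum_const_seq mulrA -natrM.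
  by rewrite sum_const_seq mulrA -natrM mulnA.
rewrite big_flatten big_map.
apply: (@le_trans _ _ (\sum_(x <- B) (4 ^ k * 'C(n, k.+1))%:R * q ^+ k.+1)).
  apply: ler_sum => x _; rewrite big_seq.
  rewrite (eq_bigr (fun=> q ^+ k.+1)); last first.
    by move=> c; rewrite mem_filter => /andP[_ /size_chain->].
  rewrite -big_seq sum_const_seq ler_wpM2r ?exprn_ge0//.
  rewrite ler_nat size_filter (leq_trans (count_size _ _))// size_chains.
  by rewrite leq_mul2l leq_bin2l ?orbT.
by rewrite sum_const_seq mulrA -natrM.
Qed.

End approximation.

Lemma measurable_long_path d (T : measurableType d) (R : realType)
    (P : probability T R) (Y : site -> {RV P >-> bool}) x k :
  measurable [set w | long_path x k (fun y => Y y w)].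
Proof.
pose F (s : seq site) := [set w | [/\ size s = k, uniq (x :: s),
  path adjacent x s & all (fun y => Y y w) (x :: s)]].
rewrite (_ : mkset _ = \bigcup_s F s); last first.
  by apply/seteqP; split => w /= [s]; [move=> h; exists s|move=> _ h; exists s].
apply: countable_bigcupT_measurable => [|s]; first exact: countableP.
have [h|h] := pselect [/\ size s = k, uniq (x :: s) & path adjacent x s]; last first.
  rewrite (_ : F s = set0)//; apply/seteqP; split => // w [? ? ? _].
  by apply: h.
rewrite (_ : F s = \bigcap_(y in [set` x :: s]) Y y @^-1` [set true]).
  apply: fin_bigcap_measurable => [|y _]; first exact: finite_seq.
  by rewrite -[X in measurable X]setTI; exact: measurable_funP.
case: h => h1 h2 h3; apply/seteqP; split => w.
  by move=> [_ _ _ h] y /= /(allP h).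
by move=> h; split=> //; apply/allP => y ys; exact: h.
Qed.

Section one_space.
Context d (T : measurableType d) (R : realType) (P : probability T R).
Variables (xi : site -> {RV P >-> bool}) (tau : site -> nat -> {RV P >-> R}).
Variables (eta : R -> site -> {RV P >-> bool}) (g : nat -> R) (n : nat).
Hypothesis tau_law : forall x k A, measurable A ->
  distribution P (tau x k) A = exponential_prob 1 A.
Hypothesis indep : mutually_independent P (sources xi tau).
Hypothesis pathP : {ae P, forall w,
  majority_path (fun x => rings (fun k => tau x k w)) (fun x => xi x w)
    (fun t x => eta t x w)}.
Hypothesis g0 : g 0%N = 0.
Hypothesis g_mono : forall j, (j < n)%N -> g j <= g j.+1.

Lemma long_path_approximation (L : seq site) x0 k0 k l (d0 : site -> datum n) :
  uniq L -> (l <= n)%N -> {in site_ball k0 x0, forall x, {subset site_ball k x <= L}} ->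
  let true_event := [set w | long_path x0 k0 (fun y => eta (g l) y w)] in
  let discrete_event :=
    [set w | `[< long_path x0 k0 (run (fun=> l) (sample xi tau g L d0 w)) >]] in
  let bad := bad_event tau g n L (site_ball k0 x0) k l in
  (P true_event <= P discrete_event + P bad)%E /\
  (P discrete_event <= P true_event + P bad)%E.
Proof.
move=> uL ln BL E1 E2 E3.
have m1 : measurable E1 by exact: measurable_long_path.
have m2 : measurable E2.
  exact: (measurable_sample xi tau g (fun d => `[< long_path x0 k0 (run (fun=> l) d) >])).
have m3 : measurable E3 by exact: measurable_bad_event.
have agree := ae_agreement tau_law indep pathP g0 g_mono d0 ln BL.
split.
  apply: le_trans _ (measureU2 _ m2 m3).
  apply: le_measure_ae => //; first exact: measurableU.
  apply: filterS agree => w ag /= h1.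
  have [h3|/ag eqx] := pselect (E3 w); [by right|left].
  by apply/asboolP; apply: long_path_mono h1 => y yB; rewrite eqx.
apply: le_trans _ (measureU2 _ m1 m3).
apply: le_measure_ae => //; first exact: measurableU.
apply: filterS agree => w ag /= /asboolP h1.
have [h3|/ag eqx] := pselect (E3 w); [by right|left].
by apply: long_path_mono h1 => y yB; rewrite eqx.
Qed.

End one_space.

(** [m] equal cells on [[0, a]], then [m] equal cells on [[a, b]]. Both times are grid points, with
    indices [m] and [m + m], and the cells from [m] on make up [(a, b]]. *)
Definition grid (R : realType) (a b : R) (m j : nat) : R :=
  if (j <= m)%N then a * (j%:R / m%:R) else a + (b - a) * ((j - m)%:R / m%:R).

Section grid.
Context (R : realType) (a b : R) (m : nat).
Hypotheses (a0 : 0 <= a) (ab : a <= b) (m0 : (0 < m)%N).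

Lemma grid0 : grid a b m 0 = 0. Proof. by rewrite /grid mul0r mulr0. Qed.

Let mR : (m%:R : R) != 0. Proof. by rewrite pnatr_eq0 -lt0n. Qed.

Lemma grid_mid : grid a b m m = a. Proof. by rewrite /grid leqnn divff// mulr1. Qed.

Lemma grid_end : grid a b m (m + m) = b.
Proof.
rewrite /grid addnK divff// mulr1 ifF; last by apply/negbTE; rewrite -ltnNge -addn1 leq_add2l.
by rewrite addrC subrK.
Qed.

Lemma grid_step j : grid a b m j <= grid a b m j.+1 <= grid a b m j + b / m%:R.
Proof.
have mi : 0 <= (m%:R : R)^-1 by rewrite invr_ge0.
have [jm|mj] := ltnP j m.
  have -> : grid a b m j.+1 = grid a b m j + a / m%:R.
    by rewrite /grid jm (ltnW jm) -natr1; field.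
  by rewrite lerDl lerD2l mulr_ge0// ler_wpM2r.
have -> : grid a b m j.+1 = grid a b m j + (b - a) / m%:R.
  rewrite /grid leqNgt ltnS mj/= subSn// -natr1; move: mj.
  rewrite leq_eqVlt => /predU1P[<-|mj]; first by rewrite leqnn subnn; field.
  by rewrite leqNgt mj/=; field.
by rewrite lerDl lerD2l mulr_ge0 ?subr_ge0// ler_wpM2r// gerBl.
Qed.

Lemma grid_homo i j : grid a b m j <= grid a b m (i + j).
Proof.
elim: i => // i IHi; apply: le_trans IHi _; rewrite addSn.
by have /andP[] := grid_step (i + j).
Qed.

Lemma grid_le_end j : (j <= m + m)%N -> grid a b m j <= b.
Proof. by move=> /subnK jm; rewrite -[leRHS]grid_end -jm; exact: grid_homo. Qed.

Lemma grid_ge_mid j : (m <= j)%N -> a <= grid a b m j.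
Proof. by move=> /subnK mj; rewrite -[leLHS]grid_mid -mj; exact: grid_homo. Qed.

End grid.

Lemma leq_bin_exp n k : ('C(n, k) * k`! <= n ^ k)%N.
Proof.
rewrite bin_ffact; elim: k => // k IHk; rewrite ffactnSr expnSr.
by apply: leq_mul; rewrite ?leq_subr.
Qed.

(** The chain term is bounded uniformly in [m] by a multiple of [(8 * c) ^+ k.+1 / (k.+1)!]. So [k]
    can be fixed first, which fixes [size_L k], and a large [m] then makes the term of neighbor
    pairs small. *)
Lemma bad_bound_small (R : realType) (c e : R) (nB : nat) (size_L : nat -> nat) :
  0 <= c -> 0 < e -> exists k m, (0 < m)%N /\
  (size_L k * 4 * (m + m))%:R * (c / m%:R) ^+ 2 +
  (nB * (4 ^ k * 'C(m + m, k.+1)))%:R * (c / m%:R) ^+ k.+1 <= e.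
Proof.
move=> c0 e0.
(* The successor [nB.+1] avoids a division by zero. *)
have e2 : 0 < e / 2 / nB.+1%:R by rewrite !divr_gt0.
have /cvgr0Pnorm_lt/(_ _ e2)[K _ /(_ K.+1 (leqnSn K))/= hK] := cvg_exp_coeff (8 * c).
set L := (size_L K)%:R : R.
(* The first term equals [8 * L * c ^+ 2 / m], which this [m] brings below [e / 2]. *)
pose m := (Num.truncn (8 * L * c ^+ 2 / (e / 2))).+1.
exists K, m; split => //.
have m0 : 0 < (m%:R : R) by rewrite ltr0n.
have mn0 : (m%:R : R) != 0 by rewrite gt_eqF.
rewrite (splitr e); apply: lerD.
  have hm : 8 * L * c ^+ 2 / (e / 2) < m%:R := truncnS_gt _.
  rewrite ltr_pdivrMr ?divr_gt0// in hm.
  rewrite (_ : _ * _ = 8 * L * c ^+ 2 / m%:R); last first.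
    by rewrite !natrM natrD -/L; field.
  by rewrite ler_pdivrMr// [leRHS]mulrC ltW.
have h1 : ('C(m + m, K.+1))%:R * (K.+1)`!%:R <= (m + m)%:R ^+ K.+1 :> R.
  by rewrite -natrM -natrX ler_nat leq_bin_exp.
have f0 : 0 < (K.+1)`!%:R :> R by rewrite ltr0n fact_gt0.
have h2 : ('C(m + m, K.+1))%:R * (c / m%:R) ^+ K.+1 <= (2 * c) ^+ K.+1 / (K.+1)`!%:R.
  rewrite ler_pdivlMr//.
  apply: (@le_trans _ _ ((m + m)%:R ^+ K.+1 * (c / m%:R) ^+ K.+1)).
    by rewrite mulrAC ler_wpM2r// exprn_ge0// divr_ge0.
  rewrite -exprMn (_ : (m + m)%:R * (c / m%:R) = 2 * c)//.
  by rewrite natrD; field.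
rewrite natrM -mulrA natrM natrX -mulrA.
apply: (@le_trans _ _ (nB%:R * (4 ^+ K * ((2 * c) ^+ K.+1 / (K.+1)`!%:R)))).
  by rewrite !ler_wpM2l// exprn_ge0.
apply: (@le_trans _ _ (nB%:R * ((8 * c) ^+ K.+1 / (K.+1)`!%:R))).
  rewrite ler_wpM2l// mulrA ler_wpM2r ?invr_ge0 ?(ltW f0)//.
  rewrite (_ : 8 * c = 4 * (2 * c)); last by ring.
  rewrite [leRHS]exprMn ler_wpM2r ?exprn_ge0 ?mulr_ge0//.
  by rewrite exprS ler_peMl ?exprn_ge0// ler1n.
move: hK; rewrite /exp_coeff/= ger0_norm; last first.
  by rewrite divr_ge0// exprn_ge0// mulr_ge0.
move=> hK; apply: (@le_trans _ _ (nB.+1%:R * ((8 * c) ^+ K.+1 / (K.+1)`!%:R))).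
  by rewrite ler_wpM2r ?ler_nat// divr_ge0// exprn_ge0// mulr_ge0.
by move: hK; rewrite ltr_pdivlMr// mulrC => /ltW.
Qed.

Section clock_pattern.
Context d (T : measurableType d) (R : realType) (P : probability T R).
Variables (xi : site -> {RV P >-> bool}) (tau : site -> nat -> {RV P >-> R}).
Hypothesis tau_law : forall x k A, measurable A ->
  distribution P (tau x k) A = exponential_prob 1 A.
Hypothesis indep : mutually_independent P (sources xi tau).
Variables (a b : R) (m : nat).
Hypotheses (a0 : 0 <= a) (ab : a <= b) (b0 : 0 < b) (m0 : (0 < m)%N).

Let g := grid a b m.
Let n := (m + m)%N.

Lemma prob_cell x j : (j < n)%N ->
  (P (seqmap (tau x) @^-1` ring_in (g j) (g j.+1)) <= (b * expR b / m%:R)%:E)%E.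
Proof.
move=> jn; have /andP[g1 g2] := grid_step a0 ab m0 j.
apply: le_trans (prob_ring_in (iid_clock tau_law indep x) b0 g1 _) _.
  exact: grid_le_end.
by rewrite lee_fin [leRHS]mulrAC ler_wpM2r ?expR_ge0// lerBlDl.
Qed.

Lemma prob_late_pattern x (mu : n.-tuple bool -> R) :
  (forall rho, P (seqmap (tau x) @^-1` [set f | pattern g n f = rho]) = (mu rho)%:E) ->
  \sum_(rho : n.-tuple bool | [exists j : 'I_n, tnth rho j && (m <= j)%N]) mu rho
    <= (b - a) * expR b.
Proof.
move=> muE; pose late (rho : n.-tuple bool) := [exists j : 'I_n, tnth rho j && (m <= j)%N].
pose X w := pattern g n (seqmap (tau x) w).
have mX rho : measurable (X @^-1` [set rho]).
  by apply: (@measurable_seqmap _ _ _ _ (tau x) [set f | pattern g n f = rho]);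
    exact: sigma_pattern.
have mH : measurable [set w | late (X w)].
  rewrite (_ : mkset _ = \bigcup_(rho in [set` enum late]) (X @^-1` [set rho])).
    by apply: fin_bigcup_measurable => [|rho _]; [exact: finite_seq|exact: mX].
  apply/seteqP; split => w /= h; first by exists (X w); rewrite //= mem_enum.
  by case: h => rho /= lr Xw; rewrite mem_enum -Xw in lr.
rewrite -lee_fin -sumEFin.
apply: (@le_trans _ _ (P [set w | late (X w)])).
  rewrite (probability_partition P mH mX) big_mkcond/=; apply: lee_sum => rho _.
  case: ifPn => // lr; rewrite -muE; apply: le_measure; rewrite ?inE//.
  - exact: mX.
  - exact: measurableI.
  - by move=> w /= Xw; rewrite -/(X w) in Xw *; split; rewrite /= ?Xw.
apply: le_trans _ (prob_ring_in (iid_clock tau_law indep x) b0 ab (lexx b)).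
apply: le_measure; rewrite ?inE//.
  by apply: measurable_seqmap; exact: sigma_ring_in.
move=> w /= /existsP[j /andP[]]; rewrite tnth_mktuple => /asboolP rj mj.
apply: ring_inW rj; first exact: grid_ge_mid.
exact: grid_le_end.
Qed.

(** It suffices that the first waiting time exceeds [b], since all cells end by [b]. *)
Lemma prob_quiet_pattern x :
  ((expR (- b))%:E <= P (seqmap (tau x) @^-1` [set f | pattern g n f = quiet n]))%E.
Proof.
have h := iid_clock tau_law indep x.
have -> : (expR (- b))%:E = P (~` (tau x 0%N @^-1` `]-oo, b])).
  rewrite probability_setC; last exact: measurable_tau.
  by rewrite (prob_tau_le h)// -EFinB opprB addrCA subrr addr0.
apply: le_measure_ae.
- by apply: measurableC; exact: measurable_tau.
- by apply: measurable_seqmap; exact: sigma_pattern.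
apply: filterS (ae_tau_ge0 h) => w tau0 /=.
rewrite in_itv/= => /negP; rewrite -ltNge => bt.
apply/val_inj/(@eq_from_nth _ false); first by rewrite !size_tuple.
move=> j; rewrite size_tuple => jn; rewrite nth_pattern// nth_nseq jn.
apply: asboolF => -[k /andP[_]]; rewrite leNgt => /negP; apply.
apply: le_lt_trans (grid_le_end a0 ab m0 jn) _.
apply: lt_le_trans (psum_mono tau0 (leq0n k)).
by rewrite /psum big_ord1.
Qed.

Variable eta : R -> site -> {RV P >-> bool}.
Hypothesis pathP : {ae P, forall w,
  majority_path (fun x => rings (fun k => tau x k w)) (fun x => xi x w)
    (fun t x => eta t x w)}.

(** The ball carrying the path event, enlarged by a buffer of width [r] that a disagreement from
    outside would have to cross. *)
Definition hull (r k : nat) (x : site) : seq site :=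
  undup (flatten [seq site_ball r y | y <- site_ball k x]).

Lemma grid_approximation x k r l (e : R) (d0 : site -> datum n) : (l <= n)%N ->
  (size (hull r k x) * 4 * n)%:R * (b * expR b / m%:R) ^+ 2 +
  (size (site_ball k x) * (4 ^ r * 'C(n, r.+1)))%:R * (b * expR b / m%:R) ^+ r.+1
    <= e ->
  let true_event := [set w | long_path x k (fun y => eta (g l) y w)] in
  let discrete_event := [set w |
    `[< long_path x k (run (fun=> l) (sample xi tau g (hull r k x) d0 w)) >]] in
  (P true_event <= P discrete_event + e%:E)%E /\
  (P discrete_event <= P true_event + e%:E)%E.
Proof.
move=> ln bound E1 E2.
have g_mono j : (j < n)%N -> g j <= g j.+1.
  by move=> _; have /andP[] := grid_step a0 ab m0 j.
have g00 : g 0%N = 0 by exact: grid0.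
have q0 : 0 <= b * expR b / m%:R by rewrite divr_ge0// mulr_ge0 ?expR_ge0// ltW.
have BL : {in site_ball k x, forall y, {subset site_ball r y <= hull r k x}}.
  by move=> y yB z zy; rewrite mem_undup; apply/flatten_mapP; exists y.
have badP : (P (bad_event tau g n (hull r k x) (site_ball k x) r l) <= e%:E)%E.
  apply: le_trans (prob_bad_event tau_law indep _ _ r q0 ln prob_cell) _.
  by rewrite lee_fin.
have [le12 le21] := long_path_approximation tau_law indep pathP g00 g_mono d0
  (undup_uniq _) ln BL.
split; first by apply: (le_trans le12); exact: leeD2l.
by apply: (le_trans le21); exact: leeD2l.
Qed.

End clock_pattern.

(** Up to [e / 2] on each side, both probabilities are those of discrete dynamics on the same box
    and grid, where [expect_comparison] applies. Either of the two times may be on either side,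
    since only rings in [(a, b]] are at stake. *)
Lemma long_path_comparison (R : realType)
    d1 (T1 : measurableType d1) (P1 : probability T1 R) (p1 : {i01 R})
    (eta1 : R -> site -> {RV P1 >-> bool})
    d2 (T2 : measurableType d2) (P2 : probability T2 R) (p2 : {i01 R})
    (eta2 : R -> site -> {RV P2 >-> bool}) (a b s1 s2 : R) x k :
  is_majority_dynamics p1 eta1 -> is_majority_dynamics p2 eta2 ->
  p1%:num <= p2%:num -> 0 <= a -> a <= b -> 0 < b ->
  (b - a) * expR b <= (p2%:num - p1%:num) * expR (- b) ->
  s1 \in [:: a; b] -> s2 \in [:: a; b] ->
  (P1 [set w | long_path x k (fun y => eta1 s1 y w)] <=
   P2 [set w | long_path x k (fun y => eta2 s2 y w)])%E.
Proof.
move=> [xi1 [tau1 [xi1P tau1P ind1 path1]]] [xi2 [tau2 [xi2P tau2P ind2 path2]]].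
move=> p12 a0 ab b0 small s1ab s2ab; apply/lee_addgt0Pr => e e0.
have p1_01 : 0 <= p1%:num <= 1 by apply/andP; split.
have p2_01 : 0 <= p2%:num <= 1 by apply/andP; split.
have [|r [m [m0 bound]]] := @bad_bound_small R (b * expR b) (e / 2)
  (size (site_ball k x)) (fun r => size (hull r k x)) _ (divr_gt0 e0 (ltr0n _ 2)).
  by rewrite mulr_ge0 ?expR_ge0 ?ltW.
pose g := grid a b m; pose n := (m + m)%N; pose L := hull r k x.
pose d0 : site -> datum n := fun=> (true, quiet n).
have uL : uniq L by exact: undup_uniq.
have gidx s : s \in [:: a; b] -> exists l, [/\ (m <= l)%N, (l <= n)%N & s = g l].
  rewrite !inE => /orP[]/eqP->; [exists m|exists n].
    by rewrite leqnn leq_addr /g grid_mid.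
  by rewrite leqnn leq_addr /g grid_end.
have [l1 [ml1 l1n ->]] := gidx _ s1ab; have [l2 [ml2 l2n ->]] := gidx _ s2ab.
have [+ _] := grid_approximation tau1P ind1 a0 ab b0 m0 path1 d0 l1n bound.
move=> /le_trans; apply.
have [_ approx2] := grid_approximation tau2P ind2 a0 ab b0 m0 path2 d0 l2n bound.
rewrite [e in leRHS](splitr e) EFinD addeA; apply: leeD => //.
apply: le_trans approx2.
pose f (eta : config) := `[< long_path x k eta >].
have f_mono : forall eta zeta : config, (forall y, eta y -> zeta y) -> f eta -> f zeta.
  move=> eta zeta le_ez /asboolP h; apply/asboolP.
  by apply: long_path_mono h => y _; exact: le_ez.
(* Outside [L] the data [d0] are quiet, so the end of time there can be set to [l2], as the
   site-by-site comparison requires. *)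
pose T y := if y \in L then l1 else l2.
have runT w : run (fun=> l1) (sample xi1 tau1 g L d0 w) = run T (sample xi1 tau1 g L d0 w).
  apply: eq_dyn => y j jn; rewrite /T /sample; case: ifP => // _.
  by rewrite nth_nseq jn.
under eq_set => w do rewrite runT.
(* The law of the pattern at one site of the first space serves for every site of both spaces. *)
pose mu rho := fine (P1 (seqmap (tau1 x) @^-1` [set h | pattern g n h = rho])).
have mu1 y rho : P1 (seqmap (tau1 y) @^-1` [set h | pattern g n h = rho]) = (mu rho)%:E.
  rewrite fineK ?fin_num_measure//; last first.
    by apply: measurable_seqmap; exact: sigma_pattern.
  apply: exponential_law_unique; [exact: iid_clock ind1 _|exact: iid_clock ind1 _|].
  exact: sigma_pattern.
have mu2 y rho : P2 (seqmap (tau2 y) @^-1` [set h | pattern g n h = rho]) = (mu rho)%:E.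
  rewrite -(mu1 x); apply: exponential_law_unique.
  - exact: iid_clock ind2 _.
  - exact: iid_clock ind1 _.
  - exact: sigma_pattern.
have -> := prob_sample p1_01 xi1P tau1P ind1 mu1 (fun d => f (run T d)) d0 uL.
have -> := prob_sample p2_01 xi2P tau2P ind2 mu2 (fun d => f (run (fun=> l2) d)) d0 uL.
rewrite lee_fin; apply: (@expect_comparison _ _ f f_mono _ _ _ m l1 l2) => //.
  by move=> rho; apply: fine_ge0.
(* Late patterns weigh at most [(b - a) * expR b], quiet ones at least [expR (- b)]; the hypothesis
   [small] links the two. *)
apply: le_trans (prob_late_pattern tau1P ind1 a0 ab b0 m0 (mu1 x)) _.
apply: (le_trans small); rewrite ler_wpM2l ?subr_ge0//.
by rewrite -lee_fin -(mu1 x); exact: (prob_quiet_pattern tau1P ind1 a0 ab b0 m0).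
Qed.

Lemma long_path_full x k (eta : config) : (forall y, eta y) -> long_path x k eta.
Proof.
move=> eta1.
(* The witness is a straight ray; its strictly increasing first coordinate ensures distinct
   sites. *)
suff [s [ss us ps _]] : exists s : seq site, [/\ size s = k, uniq (x :: s),
    path adjacent x s & forall z, z \in s -> x.1 < z.1].
  by exists s; split=> //; apply/allP => y _; exact: eta1.
elim: k x => [|k IHk] x; first by exists [::].
have [s [ss us ps gt_s]] := IHk (x.1 + 1, x.2).
have xs z : z \in (x.1 + 1, x.2) :: s -> x.1 < z.1.
  rewrite inE => /predU1P[->|/gt_s]; first by rewrite /= ltrDl.
  by apply: lt_trans; rewrite ltrDl.
exists ((x.1 + 1, x.2) :: s); split=> //.
- by rewrite /= ss.
- by rewrite cons_uniq us andbT; apply/negP => /xs; rewrite ltxx.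
- by rewrite /= ps andbT /adjacent/= subrr opprD addNKr.
Qed.

Lemma dyn_full (xi : config) r n : (forall y, xi y) -> forall y, dyn xi r n y.
Proof.
move=> xi1; elim: n => [//|n IHn] y /=; case: ifP => _; last exact: IHn.
by rewrite /majority (eq_count (a2 := predT)) ?count_predT//; move=> z; rewrite IHn.
Qed.

(** Almost surely all sites start with opinion 1, and the discrete dynamics preserves this; the
    approximation carries it to the process. It makes the set defining the critical probability
    nonempty. *)
Lemma long_path_density1 (R : realType) d (T : measurableType d)
    (P : probability T R) (p : {i01 R}) (eta : R -> site -> {RV P >-> bool}) s x k :
  is_majority_dynamics p eta -> p%:num = 1 -> 0 <= s ->
  P [set w | long_path x k (fun y => eta s y w)] = 1%E.
Proof.
move=> [xi [tau [xiP tauP ind path]]] p1 s0.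
have m_lp := measurable_long_path (eta s) x k.
apply/eqP; rewrite eq_le probability_le1//=; apply/lee_addgt0Pr => e e0.
(* Any later time would do; this one keeps [b] positive even for [s = 0]. *)
pose b := s + 1; have sb : s <= b by rewrite lerDl.
have b0 : 0 < b by rewrite ltr_wpDl.
have [|r [m [m0 bound]]] := @bad_bound_small R (b * expR b) e
  (size (site_ball k x)) (fun r => size (hull r k x)) _ e0.
  by rewrite mulr_ge0 ?expR_ge0 ?ltW.
pose d0 : site -> datum (m + m) := fun=> (true, quiet _).
have [_] := grid_approximation tauP ind s0 sb b0 m0 path d0 (leq_addr m m) bound.
rewrite grid_mid//; apply: le_trans.
rewrite -(probability_setT P); apply: le_measure_ae => //.
  exact: (measurable_sample xi tau (grid s b m)
    (fun d => `[< long_path x k (run (fun=> m) d) >]) _ (undup_uniq _)).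
have ae_xi : {ae P, forall w, forall y, xi y w}.
  apply: ae_forall_count => y; exists (xi y @^-1` [set false]); split.
  - exact: measurable_xi.
  - apply: etrans (xiP y _ _) _ => //.
    by rewrite p1 bernoulli_probE ?ler01 ?lexx// !diracE memNset// mem_set//= mule0
      /unstable.onem subrr mul0e adde0.
  - by move=> w /= /negP /negbTE.
apply: filterS ae_xi => w xiw _ /=; apply/asboolP.
apply: long_path_full; apply: dyn_full => y.
by rewrite /sample; case: ifP => //= _; exact: xiw.
Qed.

(** * Percolation and the critical probability *)

Lemma percolates_long_path (eta : config) :
  percolates eta <-> exists x, forall k, long_path x k eta.
Proof. by split=> -[x h]; exists x; exact/infinite_clusterP. Qed.

Section percolation_events.
Context d (T : measurableType d) (R : realType) (P : probability T R).
Variable Y : site -> {RV P >-> bool}.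

Let long x k := [set w | long_path x k (fun y => Y y w)].

Let m_long x k : measurable (long x k). Proof. exact: measurable_long_path. Qed.

Let percE : [set w | percolates (fun y => Y y w)] = \bigcup_x \bigcap_k long x k.
Proof.
apply/seteqP; split => w /=.
  by move=> /percolates_long_path[x h]; exists x => // k _; exact: h.
by move=> [x _ h]; apply/percolates_long_path; exists x => k; exact: h.
Qed.

Lemma measurable_percolates : measurable [set w | percolates (fun y => Y y w)].
Proof.
rewrite percE; apply: countable_bigcupT_measurable => [|x]; first exact: countableP.
exact: bigcapT_measurable.
Qed.

Lemma prob_percolates0 :
  (forall x, P (\bigcap_k long x k) = 0%E) ->
  P [set w | percolates (fun y => Y y w)] = 0%E.
Proof.
move=> h; apply: measure_negligible; first exact: measurable_percolates.
rewrite percE; pose F n := if unpickle n is Some x then \bigcap_k long x k else set0.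
apply: (@negligibleS _ _ _ _ (\bigcup_n F n)).
  by move=> w [x _ hx]; exists (pickle x) => //; rewrite /F pickleK.
apply: negligible_bigcup => n; rewrite /F; case: unpickle => [x|]; last exact: negligible_set0.
by apply/negligibleP; [exact: bigcapT_measurable|exact: h].
Qed.

(** Continuity from above: the path events decrease in [k]. *)
Lemma prob_infinite_cluster_le x (l : \bar R) :
  (forall k, (l <= P (long x k))%E) -> (l <= P (\bigcap_k long x k))%E.
Proof.
move=> hl.
have cv : P (long x k) @[k --> \oo] --> P (\bigcap_k long x k).
  apply: nonincreasing_cvg_mu => //.
  - by rewrite ltey_eq fin_num_measure.
  - exact: bigcapT_measurable.
  - by move=> i j ij; apply/subsetPset => w; exact: long_path_le.
rewrite -(cvg_lim _ cv)//; apply: lime_ge; first by apply/cvg_ex; exists (P (\bigcap_k long x k)).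
exact: nearW.
Qed.

End percolation_events.

(** The comparison passes to the limit in [k] for each starting site. If percolation has probability
    zero on the second space, each site is almost surely in no infinite cluster on the first, and
    there are countably many sites. *)
Lemma percolation_comparison (R : realType)
    d1 (T1 : measurableType d1) (P1 : probability T1 R) (Y1 : site -> {RV P1 >-> bool})
    d2 (T2 : measurableType d2) (P2 : probability T2 R) (Y2 : site -> {RV P2 >-> bool}) :
  (forall x k, P1 [set w | long_path x k (fun y => Y1 y w)] <=
               P2 [set w | long_path x k (fun y => Y2 y w)])%E ->
  (0 < P1 [set w | percolates (fun y => Y1 y w)])%E ->
  (0 < P2 [set w | percolates (fun y => Y2 y w)])%E.
Proof.
move=> le12; rewrite !lt0e !measure_ge0 !andbT; apply: contraNN => /eqP P20.
apply/eqP/prob_percolates0 => x; apply/eqP; rewrite eq_le measure_ge0 andbT -P20.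
apply: (@le_trans _ _ (P2 (\bigcap_k [set w | long_path x k (fun y => Y2 y w)]))).
  apply: prob_infinite_cluster_le => k; apply: le_trans (le12 x k).
  apply: le_measure; rewrite ?inE.
  - by apply: bigcapT_measurable => i; exact: measurable_long_path.
  - exact: measurable_long_path.
  - by move=> w; exact.
apply: le_measure; rewrite ?inE.
- by apply: bigcapT_measurable => i; exact: measurable_long_path.
- exact: measurable_percolates.
- by move=> w h; apply/percolates_long_path; exists x => k; exact: h.
Qed.

(** * Local Lipschitz bound and continuity of the critical probability *)

Section critical.
Variables (R : realType) (d : {i01 R} -> measure_display)
  (T : forall p : {i01 R}, measurableType (d p))
  (P : forall p : {i01 R}, probability (T p) R)
  (eta : forall p : {i01 R}, R -> site -> {RV (P p) >-> bool}).
Hypothesis heta : forall p : {i01 R}, is_majority_dynamics p (eta p).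

Let percolating (t : R) : set R := [set p%:num | p in
  [set p : {i01 R} | (0 < P p [set w | percolates (fun x => eta p t x w)])%E]].

Let percolating_ge0 t : lbound (percolating t) 0.
Proof. by move=> _ [p _ <-]. Qed.

Let percolating1 t : 0 <= t -> percolating t 1.
Proof.
move=> t0; pose p : {i01 R} := Itv01 ler01 (lexx 1); exists p => //=.
pose x : site := (0, 0).
apply: (@lt_le_trans _ _ 1%E); first by rewrite lte01.
apply: (@le_trans _ _ (P p (\bigcap_k [set w | long_path x k (fun y => eta p t y w)]))).
  apply: prob_infinite_cluster_le => k.
  by rewrite (long_path_density1 _ _ (heta p)).
apply: le_measure; rewrite ?inE.
- by apply: bigcapT_measurable => i; exact: measurable_long_path.
- exact: measurable_percolates.
- by move=> w h; apply/percolates_long_path; exists x => k; exact: h.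
Qed.

Let criticalE t : critical_probability eta t = inf (percolating t). Proof. by []. Qed.

Lemma critical_probability_itv t : 0 <= t -> 0 <= critical_probability eta t <= 1.
Proof.
move=> t0; rewrite criticalE; apply/andP; split.
  by apply: lb_le_inf; [exists 1; exact: percolating1|exact: percolating_ge0].
by apply: ge_inf; [exists 0; exact: percolating_ge0|exact: percolating1].
Qed.

(** If density [p] percolates at time [s], then [p + e] percolates at time [t], by the comparison
    with density increment [e]. *)
Lemma critical_probability_le (a b s t e : R) : 0 <= a -> a <= b -> 0 < b ->
  (b - a) * expR b <= e * expR (- b) -> s \in [:: a; b] -> t \in [:: a; b] ->
  critical_probability eta t <= critical_probability eta s + e.
Proof.
move=> a0 ab b0 small sab tab.
have ge0 r : r \in [:: a; b] -> 0 <= r.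
  by rewrite !inE => /orP[]/eqP-> //; exact: ltW.
have e0 : 0 <= e.
  rewrite -(pmulr_lge0 _ (expR_gt0 (- b))) (le_trans _ small)//.
  by rewrite mulr_ge0 ?subr_ge0 ?expR_ge0.
rewrite -lerBlDr [leRHS]criticalE; apply: lb_le_inf.
  by exists 1; exact/percolating1/ge0.
move=> _ [p hp <-]; rewrite lerBlDr.
(* When [p + e] exceeds 1 it is no density, but then the bound by 1 suffices. *)
have [pe1|pe1] := leP (p%:num + e) 1; last first.
  by apply: le_trans (ltW pe1); have /andP[] := critical_probability_itv (ge0 _ tab).
have pe0 : 0 <= p%:num + e by rewrite addr_ge0.
pose p' : {i01 R} := Itv01 pe0 pe1.
rewrite criticalE; apply: ge_inf; first by exists 0; exact: percolating_ge0.
exists p' => //=; apply: percolation_comparison hp => x k.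
apply: (long_path_comparison x k (heta p) (heta p') _ a0 ab b0 _ sab tab) => /=.
  by rewrite lerDl.
by rewrite addrAC subrr add0r.
Qed.

(** The preceding bound is symmetric in the two times; the local Lipschitz constant is the
    exponential of [2 * b]. *)
Lemma critical_probability_lipschitz (a b e : R) : 0 <= a -> a < b ->
  b - a <= e * expR (- b) ^+ 2 ->
  `|critical_probability eta a - critical_probability eta b| <= e.
Proof.
move=> a0 ab bae.
have b0 : 0 < b by exact: le_lt_trans ab.
have small : (b - a) * expR b <= e * expR (- b).
  by rewrite -ler_pdivlMr ?expR_gt0// -expRN -mulrA -expr2.
have aab : a \in [:: a; b] by rewrite inE eqxx.
have bab : b \in [:: a; b] by rewrite !inE eqxx orbT.
rewrite ler_distl lerBlDr.
apply/andP; split.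
  exact: critical_probability_le a0 (ltW ab) b0 small aab bab.
exact: critical_probability_le a0 (ltW ab) b0 small bab aab.
Qed.

Lemma continuous_critical_probability :
  {within `[0, +oo[%classic, continuous (critical_probability eta)}.
Proof.
apply/subspace_continuousP => t; rewrite /= in_itv/= andbT => t0.
(* Times within distance 1 of [t] are at most [t + 1], so this [D] is a uniform admissible gap. *)
apply/cvgrPdist_le => e e0; pose D := e * expR (- (t + 1)) ^+ 2.
have D0 : 0 < D by rewrite mulr_gt0 ?exprn_gt0 ?expR_gt0.
have DE b : b <= t + 1 -> D <= e * expR (- b) ^+ 2.
  move=> bt; rewrite ler_pM2l// lerXn2r ?nnegrE ?expR_ge0//.
  by rewrite ler_expR lerN2.
rewrite near_withinE; near=> s => /=; rewrite in_itv/= andbT => s0.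
have tsD : `|t - s| < D by near: s; apply/nbhs_ballP; exists D.
have ts1 : `|t - s| < 1.
  by near: s; apply/nbhs_ballP; exists 1; [exact: ltr01|].
have [st|st|->] := ltgtP s t; last by rewrite subrr normr0 ltW.
- rewrite distrC; apply: critical_probability_lipschitz => //.
  apply: le_trans (DE _ _); last by rewrite lerDl.
  by apply: le_trans (ltW tsD); exact: ler_norm.
- apply: critical_probability_lipschitz => //.
  rewrite distrC in tsD ts1; apply: le_trans (DE _ _).
    by apply: le_trans (ltW tsD); exact: ler_norm.
  by rewrite -lerBlDl; apply: le_trans (ltW ts1); exact: ler_norm.
Unshelve. all: by end_near.
Qed.

End critical.

Theorem theorem1p3 (R : realType) (d : {i01 R} -> measure_display)
    (T : forall p : {i01 R}, measurableType (d p))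
    (P : forall p : {i01 R}, probability (T p) R)
    (eta : forall p : {i01 R}, R -> site -> {RV (P p) >-> bool})
    (heta : forall p : {i01 R}, is_majority_dynamics p (eta p)) :
  (forall t : R, 0 <= t -> 0 <= critical_probability eta t <= 1) /\
  {within `[0, +oo[%classic, continuous (critical_probability eta)}.
Proof.
split; first by move=> t; exact: critical_probability_itv.
exact: continuous_critical_probability.
Qed.
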